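(* Let $P_1,P_2,\dots,P_n$ be compatible and absolutely continuous probability measures on $\mathbb{R}$ with densities $f_1,\dots,f_n$ and characteristic functions $\psi_1,\dots,\psi_n$. If $0<\int_{-\infty}^{\infty}\prod_{i=1}^n f_i(x)\,dx<\infty$ and each $\psi_i$ is in $L^1$, then the conflation $\&(P_1,\dots,P_n)$ exists and is the unique absolutely continuous probability distribution with characteristic function $$\psi_{\&(P_1,\dots,P_n)}=\frac{\psi_1\otimes\psi_2\otimes\cdots\otimes\psi_n}{(2\pi)^{n-1}\int_{-\infty}^{\infty}\prod_{i=1}^n f_i(x)\,dx}.$$
   Context: The characteristic function of a probability measure $P$ on $\mathbb{R}$ is $\psi_P(t)=\int_{-\infty}^\infty e^{itx}\,dP(x)$, and $g\otimes h$ denotes convolution: $(g\otimes h)(t)=\int_{-\infty}^\infty g(t-s)h(s)\,ds$. Absolute continuity, densities and $L^1$ are with respect to Lebesgue measure. $\delta_x$ is the Dirac measure at $x$, and $\|\mu\|$ is the total mass of a Borel sub-probability measure $\mu$. For Borel probability measures $P_1,\dots,P_n$ on $\mathbb{R}$ and $j\in\mathbb{N}$, define the sub-probability measure $$\mu_j(P_1,\dots,P_n)=\sum_{k\in\mathbb{Z}}\ \prod_{i=1}^n P_i\big(((k-1)2^{-j},k2^{-j}]\big)\,\delta_{k2^{-j}}.$$ $P_1,\dots,P_n$ are compatible if $\|\mu_j(P_1,\dots,P_n)\|>0$ for all $j\in\mathbb{N}$. If $\mu_j(P_1,\dots,P_n)/\|\mu_j(P_1,\dots,P_n)\|$ converges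 vaguely, as $j\to\infty$, to a Borel probability measure $Q$, then $Q$ is called the conflation of $P_1,\dots,P_n$ and is written $\&(P_1,\dots,P_n)$; one then says the conflation exists. Vague convergence $\nu_j\to\nu$ of sub-probability measures means $\int f\,d\nu_j\to\int f\,d\nu$ for all continuous $f$ vanishing at infinity. *)

(* Defs.v *)
From HB Require Import structures.
From mathcomp Require Import all_boot all_order all_algebra.
From mathcomp Require Import all_classical all_reals all_analysis.
From mathcomp Require Import complex.

Set Implicit Arguments.
Unset Strict Implicit.
Unset Printing Implicit Defensive.
Import Order.TTheory GRing.Theory Num.Theory.
Import numFieldNormedType.Exports.
Local Open Scope classical_set_scope.
Local Open Scope ring_scope.
Local Open Scope complex_scope.

(* Total, and meaningful only when the real and imaginary parts of [f] are
   both integrable, [Rintegral] being [fine] of the extended-real integral. *)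
Definition Cintegral d (T : measurableType d) (R : realType)
    (mu : {measure set T -> \bar R}) (f : T -> R[i]) : R[i] :=
  Rintegral mu setT (fun x => complex.Re (f x)) +i*
  Rintegral mu setT (fun x => complex.Im (f x)).

Definition Cintegrable d (T : measurableType d) (R : realType)
    (mu : {measure set T -> \bar R}) (f : T -> R[i]) : Prop :=
  [/\ measurable_fun setT (fun x => complex.Re (f x)),
      measurable_fun setT (fun x => complex.Im (f x)) &
      (\int[mu]_x (Normc.normc (f x))%:E < +oo)%E].

Definition expi (R : realType) (u : R) : R[i] := cos u +i* sin u.

Definition charfun (R : realType) (P : probability (measurableTypeR R) R)
    (t : R) : R[i] :=
  Cintegral P (fun x : measurableTypeR R => expi (t * (x : R))).

Definition convolution (R : realType) (g h : R -> R[i]) (t : R) : R[i] :=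
  Cintegral (@lebesgue_measure R)
    (fun s : measurableTypeR R => g (t - (s : R)) * h (s : R)).

(* Associated to the left; the value for [n = 0] is a dummy. *)
Definition iter_convolution (R : realType) (n : nat)
    (g : 'I_n -> R -> R[i]) : R -> R[i] :=
  if [seq g i | i <- enum 'I_n] is g1 :: gs then foldl (@convolution R) g1 gs
  else fun=> 0.

Definition is_density (R : realType) (P : probability (measurableTypeR R) R)
    (f : R -> R) : Prop :=
  [/\ measurable_fun [set: measurableTypeR R] (f : measurableTypeR R -> R),
      forall x, 0 <= f x &
      forall A : set (measurableTypeR R), measurable A ->
        P A = (\int[@lebesgue_measure R]_(x in A) (f x)%:E)%E].

Section conflation.
Context (R : realType) (n : nat).
Variable P : 'I_n -> probability (measurableTypeR R) R.
Local Open Scope ereal_scope.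

Definition dyadic (k : int) (j : nat) : R := k%:~R / 2 ^+ j.

Definition dyadic_weight (j : nat) (k : int) : \bar R :=
  \prod_(i < n)
    P i [set` `](dyadic (k - 1) j), (dyadic k j)]].

Definition dyadic_conflation (j : nat) (A : set (measurableTypeR R)) : \bar R :=
  \esum_(k in [set: int]) (dyadic_weight j k * dirac (dyadic k j : measurableTypeR R) A).

Lemma dyadic_weight_ge0 j k : 0 <= dyadic_weight j k.
Proof. by apply: prode_ge0 => i _. Qed.

Lemma dyadic_weight_fin_num j k : dyadic_weight j k \is a fin_num.
Proof. by apply: prode_fin_num => i _; exact: fin_num_measure. Qed.

Let dyadic_term_ge0 j A k : 0 <= dyadic_weight j k * dirac (dyadic k j : measurableTypeR R) A.
Proof. by rewrite mule_ge0 ?dyadic_weight_ge0. Qed.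

Let dyadic_conflation0 j : dyadic_conflation j set0 = 0.
Proof.
by apply: esum1 => k _; rewrite measure0 mule0.
Qed.

Let dyadic_conflation_ge0 j A : 0 <= dyadic_conflation j A.
Proof. by apply: esum_ge0 => k _; exact: dyadic_term_ge0. Qed.

Let dyadic_conflation_sigma_additive j :
  semi_sigma_additive (dyadic_conflation j).
Proof.
move=> F mF tF mUF; rewrite /dyadic_conflation.
set a := fun (k : int) m => dyadic_weight j k * dirac (dyadic k j : measurableTypeR R) (F m).
suff -> : \esum_(k in [set: int])
    (dyadic_weight j k * dirac (dyadic k j : measurableTypeR R) (\bigcup_m F m)) =
    \sum_(m <oo) \esum_(k in [set: int]) a k m.
  by apply: is_cvg_ereal_nneg_natsum => m _; exact: dyadic_conflation_ge0.
have a0 k m : 0 <= a k m by exact: dyadic_term_ge0.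
transitivity (\esum_(k in [set: int]) \esum_(m in [set: nat]) a k m).
  apply: eq_esum => k _.
  rewrite -nneseries_esumT// /a -(fineK (dyadic_weight_fin_num j k)).
  rewrite nneseriesZl//; congr (_ * _).
  by rewrite (measure_semi_bigcup (dirac (dyadic k j : measurableTypeR R))).
rewrite nneseries_esumT; last by move=> m; exact: dyadic_conflation_ge0.
rewrite esum_esum// esum_esum//.
rewrite (@reindex_esum _ _ _ ([set: nat] `*`` (fun=> [set: int])) _
  (fun z => (z.2, z.1)))//.
split=> //=; first by move=> [u v] [w z] _ _ /= [-> ->].
by move=> [u v] _; exists (v, u).
Qed.

HB.instance Definition _ j := isMeasure.Build _ _ _ (dyadic_conflation j)
  (dyadic_conflation0 j) (@dyadic_conflation_ge0 j)
  (@dyadic_conflation_sigma_additive j).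

Definition compatible : Prop := forall j, 0 < dyadic_conflation j setT.

End conflation.

Definition vague_cvg (R : realType)
    (nu : nat -> {measure set (measurableTypeR R) -> \bar R})
    (nu_oo : {measure set (measurableTypeR R) -> \bar R}) : Prop :=
  forall f : R -> R, continuous f ->
    f x @[x --> +oo] --> (0 : R) -> f x @[x --> -oo] --> (0 : R) ->
    (\int[nu j]_x (f x)%:E @[j --> \oo] --> \int[nu_oo]_x (f x)%:E)%E.

(* The second argument of [mnormalize] is only used for a measure of total
   mass 0 or +oo, which does not occur for compatible families. *)
Definition is_conflation (R : realType) (n : nat)
    (P : 'I_n -> probability (measurableTypeR R) R)
    (Q : probability (measurableTypeR R) R) : Prop :=
  vague_cvg (fun j => mnormalize (dyadic_conflation P j)
                        (dirac (0 : measurableTypeR R))) Q.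

(* Main.v *)
From HB Require Import structures.
Require Import Defs.
From mathcomp Require Import all_boot all_order all_algebra.
From mathcomp Require Import all_classical all_reals all_analysis.
From mathcomp Require Import complex measurable_realfun ring lra.
Set Implicit Arguments.
Unset Strict Implicit.
Unset Printing Implicit Defensive.
Import Order.TTheory GRing.Theory Num.Theory.
Import numFieldNormedType.Exports.
Local Open Scope classical_set_scope.
Local Open Scope ring_scope.
Local Open Scope complex_scope.

(** The conflation is the probability measure whose density is the normalized
    product of the densities [f i].

    Inversion. The Fourier transform of [exp (- e |t|)] is the Poisson kernel
    ([Rintegral_cos_expRN]). Fubini's theorem thus expresses the Poisson smoothing
    of a probability [P] through its characteristic function
    ([poisson_smoothing_charfun]). Integrating the kernel over an interval gives a
    difference of arctangents, which tends to a multiple of the indicator of the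
    interval, except at its end points, as the kernel narrows. For an absolutely
    continuous [P] this recovers the masses of intervals from the characteristic
    function ([charfun_inversion]), whence uniqueness
    ([charfun_inj]). If the characteristic function is integrable, dominated
    convergence shows that [P] has the bounded continuous density
    [inversion_density P] ([inversion_densityE]), which is therefore almost
    everywhere equal to any other density of [P] ([density_ae_continuous]).

    Convergence. Fix an index [i0]. On a dyadic cell, the product of the masses
    [P i] is the mass of [P i0] times the product of the others. An integral
    against the dyadic conflation of level [j] is therefore an integral against
    [P i0] of a function that is constant on the cells
    ([Rintegral_dyadic_conflation]). After multiplication by [2 ^ (j (n - 1))] the
    other factors become averages of bounded continuous densities over the cells,
    so they are bounded and converge pointwise. Dominated convergence with respect
    to [P i0] gives the limit ([conflation_cvg]), and normalization divides by
    the limit for the constant function 1, the integral of the product of the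
    densities ([conflation_exists]).

    Characteristic function. If [phi] is the Fourier transform of an integrable
    [G], Fubini's theorem and the inversion formula show that the convolution of
    [phi] with [charfun (P i)] is the Fourier transform of
    [2 pi G (inversion_density (P i))] ([convolution_fourier]). Induction on the
    number of factors identifies the iterated convolution with
    [(2 pi) ^ (n - 1)] times the Fourier transform of the product of the densities
    ([iter_convolution_charfun]). *)

(** * Fourier transform of the two-sided exponential *)

Section poisson.
Context {R : realType}.
Implicit Types (e t u : R).

Let denom_neq0 e u : 0 < e -> e ^+ 2 + u ^+ 2 != 0.
Proof. by move=> e0; rewrite gt_eqF// ltr_pwDl// ?exprn_gt0// sqr_ge0. Qed.

(** [F e u] is a primitive of [t |-> (1 + cos (u t)) exp (- e t)]. Adding 1 to
    the cosine makes the integrand nonnegative. *)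
Let F e u t := expR (- e * t) *
  (- e^-1 + (u * sin (u * t) - e * cos (u * t)) / (e ^+ 2 + u ^+ 2)).

Let is_derive_F e u t : 0 < e ->
  is_derive t 1 (F e u) ((1 + cos (u * t)) * expR (- e * t)).
Proof.
move=> e0.
have d1 : is_derive t 1 (fun t => expR (- e * t)) (- e * expR (- e * t)).
  apply: is_derive_eq; rewrite /GRing.scale/=; ring.
apply: is_derive_eq.
rewrite /GRing.scale/=.
have e1 : e != 0 by rewrite gt_eqF.
field.
by rewrite e1 denom_neq0.
Qed.

Let F_cvg e u : 0 < e -> F e u t @[t --> +oo] --> 0.
Proof.
move=> e0.
pose M := e^-1 + (`|u| + e) / (e ^+ 2 + u ^+ 2).
have h0 : expR (- e * t) * M @[t --> +oo] --> 0.
  rewrite -(mul0r M); apply: cvgMl.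
  under eq_fun do rewrite mulNr.
  apply: (cvg_comp (fun t => e * t) (fun t => expR (- t))); last exact: cvgr_expR.
  exact: gt0_cvgMry.
apply/cvgr0Pnorm_le => /= d d0.
move/cvgr0Pnorm_le : h0 => /(_ d d0).
apply: filterS => t; apply: le_trans.
rewrite !normrM ler_wpM2l//.
apply: le_trans (ler_norm _).
rewrite (le_trans (ler_normD _ _))// normrN normfV gtr0_norm// lerD2l normrM.
rewrite normfV (ger0_norm (_ : 0 <= e ^+ 2 + u ^+ 2)) ?addr_ge0 ?sqr_ge0//.
rewrite ler_wpM2r// ?invr_ge0 ?addr_ge0 ?sqr_ge0//.
rewrite (le_trans (ler_normB _ _))// !normrM (gtr0_norm e0) lerD//.
- by apply: ler_piMr => //; rewrite ler_norml sin_geN1 sin_le1.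
- by rewrite -[leRHS]mulr1 ler_wpM2l// ?(ltW e0)// ler_norml cos_geN1 cos_le1.
Qed.

Let f e u t := (1 + cos (u * t)) * expR (- e * `|t|).

Let f_ge0 e u t : 0 <= f e u t.
Proof. by rewrite mulr_ge0 ?expR_ge0// -lerBlDl sub0r cos_geN1. Qed.

Let continuous_f e u : continuous (f e u).
Proof.
move=> t; apply: cvgM.
  apply: cvgD; first exact: cvg_cst.
  apply: (continuous_comp (f := fun t => u * t) (g := cos)); last exact: continuous_cos.
  exact: mulrl_continuous.
apply: (continuous_comp (f := fun t => - e * `|t|) (g := expR)); last exact: continuous_expR.
apply: cvgMr.
exact: norm_continuous.
Qed.

Let integral_f e u : 0 < e ->
  (\int[lebesgue_measure]_t (f e u t)%:E =
    (2 / e + 2 * e / (e ^+ 2 + u ^+ 2))%:E)%E.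
Proof.
move=> e0.
rewrite ge0_symfun_integralT//; last first.
  by move=> t; rewrite /f /= normrN mulrN cosN.
rewrite -set_itvcy.
have H : (\int[lebesgue_measure]_(t in `[0%R, +oo[) (f e u t)%:E =
  \int[lebesgue_measure]_(t in `[0%R, +oo[)
    ((1 + cos (u * t)) * expR (- e * t))%:E)%E.
  apply: eq_integral => t; rewrite inE/= in_itv/= andbT => t0.
  by rewrite /f ger0_norm.
rewrite {}H.
rewrite (@ge0_continuous_FTC2y _ _ (F e u) 0 0)//.
- rewrite -EFinB -EFinM; congr EFin.
  rewrite /F !mulr0 sin0 cos0 expR0.
  have e1 : e != 0 by rewrite gt_eqF.
  by field; rewrite e1 denom_neq0.
- apply: continuous_subspaceT => t.
  apply: cvgM.
    apply: cvgD; first exact: cvg_cst.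
    apply: (continuous_comp (f := fun t => u * t) (g := cos)); last exact: continuous_cos.
    exact: mulrl_continuous.
  apply: (continuous_comp (f := fun t => - e * t) (g := expR)); last exact: continuous_expR.
  exact: mulrl_continuous.
- exact: F_cvg.
- apply: cvg_at_right_filter.
  case: (is_derive_F u 0 e0) => + _.
  by move/derivable1_diffP/differentiable_continuous.
- by move=> t _; rewrite derive1E; case: (is_derive_F u t e0).
Qed.

Lemma integrable_expRN e : 0 < e ->
  lebesgue_measure.-integrable setT (EFin \o (fun t => expR (- e * `|t|))).
Proof.
move=> e0.
have := integral_f 0 e0.
under eq_integral do rewrite /f mul0r cos0.
move=> i2.
have i3 : lebesgue_measure.-integrable setT
    (EFin \o (fun t : R => (1 + 1) * expR (- e * `|t|))).
  apply/integrableP; split.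
    apply/measurable_EFinP.
    have := @continuous_f e 0.
    rewrite /f; under eq_fun do rewrite mul0r cos0.
    exact: continuous_measurable_fun.
  under eq_integral.
    move=> t _ /=; rewrite ger0_norm; last first.
      by rewrite mulr_ge0// expR_ge0.
    over.
  by rewrite i2 ltry.
have := integrableZl measurableT (2^-1) i3.
apply: eq_integrable => // t _ /=.
by rewrite -EFinM mulrA mulVf ?mul1r.
Qed.

(** The Fourier transform of [exp (- e |t|)] is the Poisson kernel. *)
Lemma Rintegral_cos_expRN e u : 0 < e ->
  \int[lebesgue_measure]_t (cos (u * t) * expR (- e * `|t|)) =
    2 * e / (e ^+ 2 + u ^+ 2).
Proof.
move=> e0.
have h v : \int[lebesgue_measure]_t f e v t = 2 / e + 2 * e / (e ^+ 2 + v ^+ 2).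
  by rewrite /Rintegral integral_f.
have intf v : lebesgue_measure.-integrable setT (EFin \o f e v).
  apply/integrableP; split.
    by apply/measurable_EFinP; exact: continuous_measurable_fun.
  under eq_integral do rewrite /= ger0_norm//.
  by rewrite integral_f// ltry.
(* Remove the 1 that was added to the cosine: [f e 0] is twice the exponential. *)
have -> : \int[lebesgue_measure]_t (cos (u * t) * expR (- e * `|t|)) =
   \int[lebesgue_measure]_t (f e u t - 2^-1 * f e 0 t).
  apply: eq_Rintegral => t _; rewrite /f mul0r cos0.
  by field.
transitivity ((\int[lebesgue_measure]_t f e u t) -
    (\int[lebesgue_measure]_t (2^-1 * f e 0 t))).
  apply: RintegralB => //.
  exact: (integrableZl measurableT (2^-1) (intf 0)).
transitivity ((2 / e + 2 * e / (e ^+ 2 + u ^+ 2)) -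
    2^-1 * (\int[lebesgue_measure]_t f e 0 t)).
  by congr (_ - _); [exact: h|exact: RintegralZl].
rewrite h.
have e1 : e != 0 by rewrite gt_eqF.
by field; rewrite e1 denom_neq0.
Qed.

End poisson.

(** * Fubini's theorem for bounded kernels *)

Section bounded_kernel_fubini.
Context {R : realType}.
Local Notation T := (measurableTypeR R).
Variables (m1 m2 : {sigma_finite_measure set T -> \bar R}).
Variables (g u : R -> R) (k : R -> R -> R) (C : R).
Hypotheses (ig : m1.-integrable setT (EFin \o g))
  (iu : m2.-integrable setT (EFin \o u))
  (mk : measurable_fun [set: T * T] (fun z => k z.1 z.2))
  (kC : forall x s, `|k x s| <= C).

Let F (z : T * T) : \bar R := (g z.1 * k z.1 z.2 * u z.2)%:E.

Let mg : measurable_fun [set: T] g.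
Proof. by apply/measurable_EFinP; exact: (measurable_int _ ig). Qed.

Let mu_ : measurable_fun [set: T] u.
Proof. by apply/measurable_EFinP; exact: (measurable_int _ iu). Qed.

Let mF : measurable_fun setT F.
Proof.
apply/measurable_EFinP; apply: measurable_funM; last first.
  by apply: (measurableT_comp mu_); exact: measurable_snd.
apply: measurable_funM => //.
by apply: (measurableT_comp mg); exact: measurable_fst.
Qed.

Let iF : (m1 \x m2)%E.-integrable setT F.
Proof.
have mag : measurable_fun [set: T] (fun x => `|(g x)%:E|%E).
  by apply: measurableT_comp => //; apply/measurable_EFinP.
have mau : measurable_fun [set: T] (fun x => `|(u x)%:E|%E).
  by apply: measurableT_comp => //; apply/measurable_EFinP.
apply/(integrable12ltyP _ _ mF).
have C0 : 0 <= C by rewrite (le_trans _ (kC 0 0)).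
have iu0 : (0 <= \int[m2]_y `|(u y)%:E|)%E by exact: integral_ge0.
apply: (@le_lt_trans _ _ (\int[m1]_x (`|(g x)%:E| * (C%:E * \int[m2]_y `|(u y)%:E|)))%E).
  apply: ge0_le_integral => //.
  - by move=> x _; exact: integral_ge0.
  - apply: (measurable_fun_fubini_tonelli_F (abse \o F)).
      by apply: measurableT_comp.
    by move=> z; exact: abse_ge0.
  - by apply: emeasurable_funM => //; exact: measurable_cst.
  - move=> x _; rewrite -ge0_integralZl// -ge0_integralZl//=; last 2 first.
    + exact: measurable_funeM.
    + by move=> s _; rewrite mule_ge0.
    apply: ge0_le_integral => //.
    + rewrite -[X in measurable_fun _ X]/(abse \o (F \o pair x)).
      by apply: measurableT_comp => //; exact: measurableT_comp.
    + by do 2 apply: measurable_funeM.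
    + move=> s _; rewrite /F/= !normrM !EFinM -muleA lee_wpmul2l//.
      by rewrite lee_wpmul2r// lee_fin.
rewrite ge0_integralZr//; last by rewrite mule_ge0.
have iu' : (C%:E * \int[m2]_y `|(u y)%:E|)%E \is a fin_num.
  by rewrite fin_numM// ge0_fin_numE//; case/integrableP : iu.
have ig' : (\int[m1]_x `|(g x)%:E|)%E \is a fin_num.
  by rewrite ge0_fin_numE//; [case/integrableP : ig|exact: integral_ge0].
by rewrite ltey_eq fin_numM.
Qed.

Let bounded_kernel1 x : [bounded k x s | s in [set: T]].
Proof.
exists C; split; first exact: num_real.
by move=> M CM s _; exact: le_trans (kC _ _) (ltW CM).
Qed.

Let bounded_kernel2 s : [bounded k x s | x in [set: T]].
Proof.
exists C; split; first exact: num_real.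
by move=> M CM x _; exact: le_trans (kC _ _) (ltW CM).
Qed.

Let kg s : m1.-integrable setT (EFin \o (fun x => g x * k x s)).
Proof.
have mk2 : measurable_fun [set: T] (k ^~ s) by exact: (measurable_fun_pair1 s mk).
by have := integrableMl measurableT ig mk2 (bounded_kernel2 s); apply: eq_integrable.
Qed.

Lemma integrable_kernel x : m2.-integrable setT (EFin \o (fun s => k x s * u s)).
Proof.
have mk1 : measurable_fun [set: T] (k x) by exact: (measurable_fun_pair2 x mk).
by have := integrableMr measurableT mk1 (bounded_kernel1 x) iu; apply: eq_integrable.
Qed.

Let inner1 s : ((\int[m1]_x (g x * k x s)) * u s)%:E = (\int[m1]_x F (x, s))%E.
Proof.
rewrite EFinM fineK; last by apply: integrable_fin_num => //; exact: kg.
by rewrite -integralZr//; exact: kg.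
Qed.

Let inner2 x : (g x * \int[m2]_s (k x s * u s))%:E = (\int[m2]_s F (x, s))%E.
Proof.
rewrite EFinM fineK; last by apply: integrable_fin_num => //; exact: integrable_kernel.
rewrite -integralZl//; last exact: integrable_kernel.
by apply: eq_integral => s _; rewrite /F/= -!EFinM mulrA.
Qed.

Lemma integrable_kernel_right :
  m1.-integrable setT (EFin \o (fun x => g x * \int[m2]_s (k x s * u s))).
Proof.
by have := integrable_fubini_F iF; apply: eq_integrable => // x _; rewrite /= inner2.
Qed.

(** Fubini's theorem for [g x * k x s * u s], where [g] and [u] are integrable and
    the kernel [k] is bounded. *)
Lemma Rintegral_kernel_swap :
  \int[m2]_s ((\int[m1]_x (g x * k x s)) * u s) =
  \int[m1]_x (g x * \int[m2]_s (k x s * u s)).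
Proof.
congr fine; under eq_integral do rewrite inner1.
under [RHS]eq_integral do rewrite inner2.
by rewrite Fubini.
Qed.

End bounded_kernel_fubini.

Lemma integrable_kernel_left {R : realType}
    (m1 m2 : {sigma_finite_measure set (measurableTypeR R) -> \bar R})
    (g u : R -> R) (k : R -> R -> R) (C : R) :
  m1.-integrable setT (EFin \o g) -> m2.-integrable setT (EFin \o u) ->
  measurable_fun [set: measurableTypeR R * measurableTypeR R]
    (fun z => k z.1 z.2) ->
  (forall x s, `|k x s| <= C) ->
  m2.-integrable setT (EFin \o (fun s => (\int[m1]_x (g x * k x s)) * u s)).
Proof.
move=> ig iu mk kC.
have mk' : measurable_fun [set: measurableTypeR R * measurableTypeR R]
    (fun z => k z.2 z.1).
  have H := measurableT_comp mk (@measurable_swap _ _ (measurableTypeR R) (measurableTypeR R)).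
  exact: H.
have := integrable_kernel_right iu ig mk' (fun s x => kC x s).
apply: eq_integrable => // s _ /=; rewrite mulrC; congr (_ * _)%:E.
by apply: eq_Rintegral => x _; rewrite mulrC.
Qed.

(** * Poisson smoothing of a probability measure *)

Section inversion.
Context {R : realType}.
Local Notation T := (measurableTypeR R).
Local Notation leb := (@lebesgue_measure R).
Implicit Types (P : probability T R) (a b e x y t : R).

Lemma measurable_cos : measurable_fun [set: T] (@cos R).
Proof. by apply: continuous_measurable_fun; exact: continuous_cos. Qed.

Lemma measurable_sin : measurable_fun [set: T] (@sin R).
Proof. by apply: continuous_measurable_fun; exact: continuous_sin. Qed.

Lemma normr_cos_le1 x : `|cos x| <= 1.
Proof. by rewrite ler_norml cos_geN1 cos_le1. Qed.

Lemma normr_sin_le1 x : `|sin x| <= 1.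
Proof. by rewrite ler_norml sin_geN1 sin_le1. Qed.

Lemma bounded_integrable (m : {finite_measure set T -> \bar R}) (h : R -> R)
    (C : R) : measurable_fun [set: T] h -> (forall x, `|h x| <= C) ->
  m.-integrable setT (EFin \o h).
Proof.
move=> mh hC; apply: measurable_bounded_integrable => //.
  exact: fin_num_fun_lty.
exists C; split; first exact: num_real.
by move=> M CM x _; exact: le_trans (hC x) (ltW CM).
Qed.

Lemma integrable_cst_finite (m : {finite_measure set T -> \bar R}) (c : R) :
  m.-integrable setT (EFin \o (fun=> c)).
Proof. by apply: (@bounded_integrable m _ `|c|) => //; exact: measurable_cst. Qed.

Lemma integrable_cos P t : P.-integrable setT (EFin \o (fun x => cos (t * x))).
Proof.
apply: (@bounded_integrable P _ 1); last by move=> x; exact: normr_cos_le1.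
by apply: (measurableT_comp measurable_cos); exact: measurable_funM.
Qed.

Lemma integrable_sin P t : P.-integrable setT (EFin \o (fun x => sin (t * x))).
Proof.
apply: (@bounded_integrable P _ 1); last by move=> x; exact: normr_sin_le1.
by apply: (measurableT_comp measurable_sin); exact: measurable_funM.
Qed.

(** The real part of [charfun P t * exp (- i t y)]. Its imaginary part is odd in
    [t], so it contributes nothing to the Fourier inversion integral. *)
Definition inversion_integrand P y t : R :=
  complex.Re (charfun P t) * cos (t * y) + complex.Im (charfun P t) * sin (t * y).

Lemma inversion_integrandE P y t :
  inversion_integrand P y t = \int[P]_x cos ((x - y) * t).
Proof.
rewrite /inversion_integrand /charfun/=.
rewrite -(@RintegralZr _ _ _ P _ _ _ measurableT (integrable_cos P t)).
rewrite -(@RintegralZr _ _ _ P _ _ _ measurableT (integrable_sin P t)).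
rewrite -RintegralD//; last 2 first.
  by have := integrableZr measurableT (cos (t * y)) (integrable_cos P t).
  by have := integrableZr measurableT (sin (t * y)) (integrable_sin P t).
apply: eq_Rintegral => x _; rewrite mulrBl cosB.
by rewrite (mulrC x t) (mulrC y t).
Qed.

(** The convolution of [P] with the Poisson kernel depends on [P] only through its
    characteristic function. *)
Lemma poisson_smoothing_charfun P e y : 0 < e ->
  \int[P]_x (2 * e / (e ^+ 2 + (x - y) ^+ 2)) =
  \int[leb]_t (inversion_integrand P y t * expR (- e * `|t|)).
Proof.
move=> e0.
under [RHS]eq_Rintegral do rewrite inversion_integrandE.
have := @Rintegral_kernel_swap R P leb (fun=> 1) (fun t => expR (- e * `|t|))
  (fun x t => cos ((x - y) * t)) 1 (integrable_cst_finite P 1)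
  (integrable_expRN e0).
move=> H.
transitivity (\int[P]_x (1 * \int[leb]_t (cos ((x - y) * t) * expR (- e * `|t|)))).
  by apply: eq_Rintegral => x _; rewrite Rintegral_cos_expRN// mul1r.
rewrite -H.
- apply: eq_Rintegral => t _; congr (_ * _).
  by apply: eq_Rintegral => x _; rewrite mul1r.
- apply: (measurableT_comp measurable_cos); apply: measurable_funM.
    by apply: measurable_funB => //; exact: measurable_fst.
  exact: measurable_snd.
- by move=> x t; exact: normr_cos_le1.
Qed.

Lemma continuous_poisson_kernel e : 0 < e ->
  continuous (fun u : R => 2 * e / (e ^+ 2 + u ^+ 2)).
Proof.
move=> e0 u; apply: (@cvgM _ _ (nbhs u)); first exact: cvg_cst.
apply: (@cvgV _ _ (nbhs u)).
  by rewrite gt_eqF// ltr_pwDl// ?exprn_gt0// sqr_ge0.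
apply: cvgD; first exact: cvg_cst.
by apply: cvgM; exact: cvg_id.
Qed.

Lemma integral_poisson_kernel e x a b : 0 < e -> a < b ->
  \int[leb]_(y in `[a, b]) (2 * e / (e ^+ 2 + (x - y) ^+ 2)) =
  2 * (atan ((b - x) / e) - atan ((a - x) / e)).
Proof.
move=> e0 ab.
have dn y : e ^+ 2 + (x - y) ^+ 2 != 0.
  by rewrite gt_eqF// ltr_pwDl// ?exprn_gt0// sqr_ge0.
have e1 : e != 0 by rewrite gt_eqF.
pose F y : R := 2 * atan ((y - x) / e).
have dF (y : R) : is_derive y 1 F (2 * e / (e ^+ 2 + (x - y) ^+ 2)).
  apply: is_derive_eq; rewrite /GRing.scale/=.
  rewrite -(opprB y x) sqrrN.
  have dn2 : e ^+ 2 + (y - x) ^+ 2 != 0 by rewrite -(opprB x y) sqrrN.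
  by field; rewrite e1 dn2.
rewrite /Rintegral (@continuous_FTC2 _ _ F)//=.
- by rewrite /F -mulrBr.
- apply: continuous_subspaceT => y.
  apply: (@continuous_comp R R R (fun y => x - y)
    (fun u => 2 * e / (e ^+ 2 + u ^+ 2))); last exact: continuous_poisson_kernel.
  by apply: cvgB; [exact: cvg_cst|exact: cvg_id].
- have cF : continuous F.
    by move=> y; case: (dF y) => + _; move/derivable1_diffP/differentiable_continuous.
  split.
  + by move=> y _; case: (dF y).
  + by apply: cvg_at_right_filter; exact: cF.
  + by apply: cvg_at_left_filter; exact: cF.
- by move=> y _; rewrite derive1E; case: (dF y).
Qed.

Lemma integral_poisson_smoothing P e a b : 0 < e -> a < b ->
  \int[leb]_(y in `[a, b]) \int[P]_x (2 * e / (e ^+ 2 + (x - y) ^+ 2)) =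
  \int[P]_x (2 * (atan ((b - x) / e) - atan ((a - x) / e))).
Proof.
move=> e0 ab.
have mab : measurable (`[a, b]%classic : set T) by exact: measurable_itv.
have iab : leb.-integrable setT (EFin \o \1_(`[a, b]%classic : set T)).
  exact: integrable_indic_itv.
rewrite Rintegral_mkcond.
have H := @Rintegral_kernel_swap R P leb (fun=> 1) (\1_(`[a, b]%classic : set T))
  (fun x y => 2 * e / (e ^+ 2 + (x - y) ^+ 2)) (2 / e) (integrable_cst_finite P 1)
  iab.
transitivity (\int[leb]_y ((\int[P]_x (1 * (2 * e / (e ^+ 2 + (x - y) ^+ 2)))) *
    \1_(`[a, b]%classic : set T) y)).
  apply: eq_Rintegral => y _; rewrite patchE indicE.
  under [in RHS]eq_Rintegral do rewrite mul1r.
  by case: ifPn => yab; rewrite ?mulr1 ?mulr0.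
rewrite H.
- apply: eq_Rintegral => x _; rewrite mul1r -integral_poisson_kernel//.
  rewrite [RHS]Rintegral_mkcond; apply: eq_Rintegral => y _.
  rewrite patchE indicE.
  by case: ifPn => yab; rewrite ?mulr1 ?mulr0.
- apply: (@measurableT_comp _ _ _ _ _ _ (fun u : T => 2 * e / (e ^+ 2 + u ^+ 2))).
    by apply: continuous_measurable_fun; exact: continuous_poisson_kernel.
  by apply: measurable_funB; [exact: measurable_fst|exact: measurable_snd].
- move=> x y.
  have d0 : 0 < e ^+ 2 + (x - y) ^+ 2 by rewrite ltr_pwDl// ?exprn_gt0// sqr_ge0.
  rewrite ger0_norm; last by rewrite divr_ge0// ?mulr_ge0// ltW.
  rewrite ler_pdivrMr// -mulrA ler_pM2l// -ler_pdivrMl ?invr_gt0// invrK.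
  by rewrite -expr2 lerDl sqr_ge0.
Qed.

Lemma null_dominates_set1 P x : P `<< leb -> P [set x] = 0%E.
Proof.
by move/null_content_dominatesP; apply => //; exact: lebesgue_measure_set1.
Qed.

Lemma atan_cvg_scale (c : R) : 0 < c ->
  atan (c * n.+1%:R) @[n --> \oo] --> pi / 2.
Proof.
move=> c0.
apply: (cvg_comp (fun n => c * n.+1%:R) (@atan R)); last exact: cvgy_atan.
apply/cvgryPge => A.
near=> n.
rewrite mulrC -ler_pdivrMr//.
apply: le_trans (_ : n%:R <= _); last by rewrite ler_nat.
by near: n; exact: nbhs_infty_ger.
Unshelve. all: by end_near. Qed.

Lemma atan_cvg_scaleN (c : R) : c < 0 ->
  atan (c * n.+1%:R) @[n --> \oo] --> - (pi / 2).
Proof.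
move=> c0.
have Nc0 : 0 < - c by rewrite oppr_gt0.
have -> : (fun n => atan (c * n.+1%:R)) = (fun n => - atan (- c * n.+1%:R)).
  by apply/funext => n; rewrite mulNr atanN opprK.
exact: (cvgN (atan_cvg_scale Nc0)).
Qed.

(** As the width [1 / n.+1] of the Poisson kernel tends to 0, the integrand tends
    to [2 pi] times the indicator of the interval from [a] to [b], except at its
    end points, which are not atoms of [P]. *)
Lemma poisson_smoothing_cvg P a b : P `<< leb -> a < b ->
  \int[P]_x (2 * (atan ((b - x) * n.+1%:R) - atan ((a - x) * n.+1%:R)))
    @[n --> \oo] --> 2 * pi * fine (P `]a, b]%classic).
Proof.
move=> Pleb ab.
have mab : measurable (`]a, b]%classic : set T) by exact: measurable_itv.
have iP : (\int[P]_x ((2 * pi * \1_(`]a, b]%classic : set T) x)%:E) =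
   (2 * pi)%:E * P `]a, b]%classic)%E.
  under eq_integral do rewrite EFinM.
  rewrite ge0_integralZl//.
  - by rewrite integral_indic// setIT.
  - by apply/measurable_EFinP; exact: measurable_indic.
  - by rewrite lee_fin mulr_ge0// pi_ge0.
have -> : 2 * pi * fine (P `]a, b]%classic) =
    fine (\int[P]_x ((2 * pi * \1_(`]a, b]%classic : set T) x)%:E)).
  by rewrite iP fineM//; exact: fin_num_measure.
apply: fine_cvg.
rewrite fineK; last by rewrite iP fin_numM//; exact: fin_num_measure.
have [] := @dominated_convergence _ T R P setT measurableT
  (fun n x => (2 * (atan ((b - x) * n.+1%:R) - atan ((a - x) * n.+1%:R)))%:E)
  (fun x => (2 * pi * \1_(`]a, b]%classic : set T) x)%:E)
  (fun=> (2 * pi)%:E).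
- move=> n; apply/measurable_EFinP.
  have ma (c : R) : measurable_fun [set: T] (fun x : T => atan ((c - x) * n.+1%:R)).
    apply: measurableT_comp.
      by apply: continuous_measurable_fun => x; exact: continuous_atan.
    by apply: measurable_funM => //; exact: measurable_funB.
  by apply: measurable_funM => //; exact: measurable_funB.
- by apply/measurable_EFinP; apply: measurable_funM => //; exact: measurable_indic.
- exists ([set a] `|` [set b]); split.
  + exact: measurableU.
  + apply: null_set_setU => //; exact: null_dominates_set1.
  + move=> x /= H; apply: contrapT => /not_orP[xa xb]; apply: H => _.
    apply: cvg_EFin; first exact: nearW.
    rewrite /comp/=.
    rewrite indicE mem_setE in_itv/=.
    have {}xa : x != a by apply/eqP.
    have {}xb : x != b by apply/eqP.
    have [xa'|ax] := ltP x a.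
      have xb' : x < b by exact: lt_trans ab.
      rewrite (lt_gtF xa')/= mulr0 -(mulr0 2) -(subrr (pi / 2)).
      apply: cvgMr; apply: cvgB; apply: atan_cvg_scale; by rewrite subr_gt0.
    have {}ax : a < x by rewrite lt_neqAle eq_sym xa.
    have [bx|xb'] := ltP b x.
      rewrite ax/= mulr0 -(mulr0 2) -(subrr (- (pi / 2))).
      by apply: cvgMr; apply: cvgB; apply: atan_cvg_scaleN; rewrite subr_lt0.
    have {}xb' : x < b by rewrite lt_neqAle xb.
    rewrite ax/= mulr1 [X in 2 * X](_ : pi = pi / 2 - - (pi / 2)); last first.
      by rewrite opprK -splitr.
    apply: cvgMr; apply: cvgB.
      by apply: atan_cvg_scale; rewrite subr_gt0.
    by apply: atan_cvg_scaleN; rewrite subr_lt0.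
- exact: integrable_cst_finite.
- apply: aeW => x n _ /=; rewrite lee_fin normrM ger0_norm// ler_pM2l//.
  rewrite ler_norml.
  have := atan_gtNpi2 ((b - x) * n.+1%:R).
  have := atan_gtNpi2 ((a - x) * n.+1%:R).
  have := atan_ltpi2 ((b - x) * n.+1%:R).
  have := atan_ltpi2 ((a - x) * n.+1%:R).
  lra.
- by move=> _ _.
Qed.

End inversion.

(** * Inversion and uniqueness for characteristic functions *)

Section inversion_theorem.
Context {R : realType}.
Local Notation T := (measurableTypeR R).
Local Notation leb := (@lebesgue_measure R).
Implicit Types (P Q : probability T R) (a b e x y t : R).

(** Fourier inversion with Abel summation, for an absolutely continuous [P] whose
    characteristic function need not be integrable. *)
Lemma charfun_inversion P a b : P `<< leb -> a < b ->
  \int[leb]_(y in `[a, b]) \int[leb]_t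
      (inversion_integrand P y t * expR (- n.+1%:R^-1 * `|t|))
    @[n --> \oo] --> 2 * pi * fine (P `]a, b]%classic).
Proof.
move=> Pleb ab; apply: cvg_trans (poisson_smoothing_cvg Pleb ab).
apply: near_eq_cvg; apply: nearW => n.
have n0 : 0 < n.+1%:R^-1 :> R by rewrite invr_gt0.
transitivity (\int[P]_x (2 * (atan ((b - x) / n.+1%:R^-1) - atan ((a - x) / n.+1%:R^-1)))).
  by apply: eq_Rintegral => x _; rewrite invrK.
rewrite -integral_poisson_smoothing//.
by apply: eq_Rintegral => y _; rewrite poisson_smoothing_charfun.
Qed.

Lemma eq_measure_ocitv (m1 m2 : {measure set T -> \bar R}) :
  (forall a b, a < b -> m1 `]a, b]%classic = m2 `]a, b]%classic) ->
  (m1 setT < +oo)%E -> forall A, measurable A -> m1 A = m2 A.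
Proof.
move=> m12 m1oo A mA.
apply: (@measure_unique _ R T (@ocitv R) (fun n => `](- n%:R), n%:R]%classic)) => //.
- exact: ocitvI.
- by move=> n; exact: is_ocitv.
- apply/seteqP; split => // x _.
  exists (Num.truncn `|x|).+1 => //=.
  have := truncnS_gt `|x|; rewrite ltr_norml in_itv/= => /andP[-> /ltW].
  exact.
- move=> B [[a b] _ <-]/=.
  have [ab|ba] := ltP a b; first exact: m12.
  by rewrite set_itv_ge ?measure0// bnd_simp -leNgt.
- by move=> k; apply: le_lt_trans m1oo; apply: le_measure => //; rewrite inE.
Qed.

Lemma charfun_inj P Q : P `<< leb -> Q `<< leb ->
  (forall t, charfun P t = charfun Q t) ->
  forall A, measurable A -> P A = Q A.
Proof.
move=> Pleb Qleb PQ; apply: eq_measure_ocitv; last first.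
  by rewrite -ge0_fin_numE//; exact: fin_num_measure.
move=> a b ab.
have PQE : inversion_integrand P = inversion_integrand Q.
  by apply/funext => y; apply/funext => t; rewrite /inversion_integrand PQ.
have cP := charfun_inversion Pleb ab; rewrite PQE in cP.
have E : 2 * pi * fine (P `]a, b]%classic) = 2 * pi * fine (Q `]a, b]%classic).
  by apply: (cvg_unique _ cP (charfun_inversion Qleb ab)).
have pi0 : 2 * pi != 0 :> R by rewrite mulf_neq0// gt_eqF// pi_gt0.
have := congr1 EFin (mulfI pi0 E).
by rewrite !fineK//; exact: fin_num_measure.
Qed.

Section integrable_charfun.
Variable P : probability T R.
Hypothesis Pleb : P `<< leb.
Hypothesis psiL1 : Cintegrable leb (charfun P).
Local Notation rpsi := (fun t => complex.Re (charfun P t)).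
Local Notation ipsi := (fun t => complex.Im (charfun P t)).

Let mpsi : measurable_fun [set: T] (fun t => Normc.normc (charfun P t)).
Proof.
case: psiL1 => mRe mIm _.
have -> : (fun t => Normc.normc (charfun P t)) =
    (fun t => Num.sqrt (rpsi t ^+ 2 + ipsi t ^+ 2)).
  by apply/funext => t; case: (charfun P t).
apply: (measurableT_comp (f := @Num.sqrt R)).
  by apply: continuous_measurable_fun; exact: sqrt_continuous.
by apply: measurable_funD; exact: measurable_funX.
Qed.

Lemma integrable_Re_charfun : leb.-integrable setT (EFin \o rpsi).
Proof.
case: psiL1 => mRe mIm normoo.
apply/integrableP; split; first exact/measurable_EFinP.
apply: le_lt_trans normoo; apply: ge0_le_integral => //.
- by apply: measurableT_comp => //; exact/measurable_EFinP.
- exact/measurable_EFinP.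
- move=> t _; rewrite lee_fin; case: (charfun P t) => u v /=.
  by rewrite -sqrtr_sqr ler_wsqrtr// lerDl sqr_ge0.
Qed.

Lemma integrable_Im_charfun : leb.-integrable setT (EFin \o ipsi).
Proof.
case: psiL1 => mRe mIm normoo.
apply/integrableP; split; first exact/measurable_EFinP.
apply: le_lt_trans normoo; apply: ge0_le_integral => //.
- by apply: measurableT_comp => //; exact/measurable_EFinP.
- exact/measurable_EFinP.
- move=> t _; rewrite lee_fin; case: (charfun P t) => u v /=.
  by rewrite -sqrtr_sqr ler_wsqrtr// lerDr sqr_ge0.
Qed.

Let G t := `|rpsi t| + `|ipsi t|.

Let iG : leb.-integrable setT (EFin \o G).
Proof.
have := integrableD measurableT (integrable_norm integrable_Re_charfun)
  (integrable_norm integrable_Im_charfun).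
exact: eq_integrable.
Qed.

Let mintegrand y : measurable_fun [set: T] (inversion_integrand P y).
Proof.
case: psiL1 => mRe mIm _.
apply: measurable_funD; apply: measurable_funM => //.
  by apply: (measurableT_comp measurable_cos); exact: measurable_funM.
by apply: (measurableT_comp measurable_sin); exact: measurable_funM.
Qed.

Let integrand_le y t : `|inversion_integrand P y t| <= G t.
Proof.
rewrite (le_trans (ler_normD _ _))// !normrM lerD//.
- by apply: ler_piMr => //; exact: normr_cos_le1.
- by apply: ler_piMr => //; exact: normr_sin_le1.
Qed.

Lemma integrable_inversion_integrand y :
  leb.-integrable setT (EFin \o inversion_integrand P y).
Proof.
apply: le_integrable iG => //; first exact/measurable_EFinP.
by move=> t _; rewrite lee_fin/= (le_trans (integrand_le _ _))// ler_norm.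
Qed.

(* The weight [w] stands for the constant 1 and for the Abel factors
   [exp (- e |t|)] with [e > 0]. *)
Section weight.
Variable w : R -> R.
Hypotheses (mw : measurable_fun [set: T] w) (w1 : forall t, `|w t| <= 1).

Lemma weighted_integrand_le y t : `|inversion_integrand P y t * w t| <= G t.
Proof.
rewrite normrM (le_trans _ (integrand_le y t))//.
by apply: ler_piMr.
Qed.

Let integrable_weighted_integrand y : leb.-integrable setT
  (EFin \o (fun t => inversion_integrand P y t * w t)).
Proof.
apply: le_integrable iG => //.
  by apply/measurable_EFinP; exact: measurable_funM.
by move=> t _; rewrite lee_fin/= (le_trans (weighted_integrand_le _ _))// ler_norm.
Qed.

Lemma normr_weighted_integral_le y :
  `|\int[leb]_t (inversion_integrand P y t * w t)| <= \int[leb]_t G t.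
Proof.
apply: (le_trans (le_normr_Rintegral _ _)) => //.
apply: le_Rintegral => //; first exact: integrable_norm.
by move=> t _; exact: weighted_integrand_le.
Qed.

Lemma continuous_weighted_integral :
  continuous (fun y => \int[leb]_t (inversion_integrand P y t * w t)).
Proof.
move=> y.
have := @continuity_under_integral R _ T leb
  (fun y t => inversion_integrand P y t * w t) setT measurableT
  (y - 1) (y + 1) (fun y _ => integrable_weighted_integrand y) _ G iG _.
apply.
- apply: aeW => t _ z _.
  apply: cvgM; last exact: cvg_cst.
  apply: cvgD; apply: cvgM; [exact: cvg_cst| | exact: cvg_cst|].
  + apply: (@continuous_comp R R R (fun z => t * z) cos); last exact: continuous_cos.
    exact: mulrl_continuous.
  + apply: (@continuous_comp R R R (fun z => t * z) sin); last exact: continuous_sin.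
    exact: mulrl_continuous.
- by move=> z _; apply: aeW => t _; exact: weighted_integrand_le.
- rewrite inE/= in_itv/=; lra.
Qed.

End weight.

(** The density that the Fourier inversion formula assigns to [P]. *)
Definition inversion_density y := (2 * pi)^-1 * \int[leb]_t inversion_integrand P y t.

Lemma continuous_inversion_density : continuous inversion_density.
Proof.
have m1 : measurable_fun [set: T] (fun=> 1 : R) by exact: measurable_cst.
have n1 (t : R) : `|1 : R| <= 1 by rewrite normr1.
have c1 := continuous_weighted_integral m1 n1.
have E : (fun y => \int[leb]_t (inversion_integrand P y t * 1)) =
    (fun y => \int[leb]_t inversion_integrand P y t).
  by apply/funext => y; apply: eq_Rintegral => t _; rewrite mulr1.
rewrite E in c1; move=> y; apply: cvgM; first exact: cvg_cst.
exact: c1.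
Qed.

Lemma inversion_density_bounded : exists M, forall y, `|inversion_density y| <= M.
Proof.
exists ((2 * pi)^-1 * \int[leb]_t G t) => y.
have pi0 : 0 <= (2 * pi)^-1 :> R by rewrite invr_ge0 mulr_ge0// pi_ge0.
rewrite normrM ger0_norm// ler_wpM2l//.
apply: (le_trans (le_normr_Rintegral _ _)) => //.
  exact: integrable_inversion_integrand.
apply: le_Rintegral => //.
exact: (integrable_norm (integrable_inversion_integrand y)).
Qed.

(* The Abel factors, which increase to 1. *)
Let w n t := expR (- n.+1%:R^-1 * `|t|) : R.

Let mw n : measurable_fun [set: T] (w n).
Proof.
apply/measurable_EFinP; apply: measurable_int (integrable_expRN _).
by rewrite invr_gt0.
Qed.

Let w1 n t : `|w n t| <= 1.
Proof.
rewrite ger0_norm ?expR_ge0// -expR0 ler_expR mulNr oppr_le0.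
by rewrite mulr_ge0// invr_ge0.
Qed.

Let w_cvg t : w n t @[n --> \oo] --> (1 : R).
Proof.
rewrite -[X in _ --> X]expR0.
have h0 : - n.+1%:R^-1 * `|t| @[n --> \oo] --> (0 : R).
  rewrite -(mul0r `|t|); apply: cvgMl.
  by rewrite -oppr0; apply: cvgN; exact: cvg_harmonic.
exact: (cvg_comp _ _ h0 (@continuous_expR R 0)).
Qed.

Let integral_w_cvg y :
  \int[leb]_t (inversion_integrand P y t * w n t) @[n --> \oo] -->
  \int[leb]_t inversion_integrand P y t.
Proof.
apply: fine_cvg.
rewrite fineK; last exact: integrable_fin_num (integrable_inversion_integrand y).
have [] := @dominated_convergence _ T R leb setT measurableT
  (fun n t => (inversion_integrand P y t * w n t)%:E)
  (EFin \o inversion_integrand P y) (EFin \o G).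
- by move=> n; apply/measurable_EFinP; exact: measurable_funM.
- exact/measurable_EFinP.
- apply: aeW => t _; apply: cvg_EFin; first exact: nearW.
  rewrite -[X in _ --> X]mulr1.
  by apply: cvgM; [exact: cvg_cst|exact: w_cvg].
- exact: iG.
- by apply: aeW => t n _; rewrite lee_fin; exact: weighted_integrand_le.
- by move=> _ _.
Qed.

Lemma inversion_densityE a b : a < b ->
  P `]a, b]%classic = (\int[leb]_(y in `[a, b]) inversion_density y)%:E.
Proof.
move=> ab; rewrite -[LHS]fineK; last exact: fin_num_measure.
congr EFin.
have pi0 : 2 * pi != 0 :> R by rewrite mulf_neq0// gt_eqF// pi_gt0.
have mab : measurable (`[a, b]%classic : set T) by exact: measurable_itv.
have iab (h : R -> R) : continuous h -> leb.-integrable `[a, b] (EFin \o h).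
  move=> ch; apply: continuous_compact_integrable; first exact: segment_compact.
  exact: continuous_subspaceT.
have cI := continuous_inversion_density.
apply: (mulfI pi0).
have -> : 2 * pi * \int[leb]_(y in `[a, b]) inversion_density y =
    \int[leb]_(y in `[a, b]) \int[leb]_t inversion_integrand P y t.
  rewrite -RintegralZl//; last exact: iab.
  by apply: eq_Rintegral => y _; rewrite /inversion_density mulrA divff// mul1r.
apply: (cvg_unique _ (charfun_inversion Pleb ab)) => //.
have iI : leb.-integrable `[a, b]
    (EFin \o (fun y => \int[leb]_t inversion_integrand P y t)).
  have := integrableZl mab (2 * pi) (iab _ cI).
  apply: eq_integrable => // y _.
  by rewrite /= -EFinM /inversion_density mulrA divff// mul1r.
apply: fine_cvg.
rewrite fineK; last exact: integrable_fin_num iI.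
have [] := @dominated_convergence _ T R leb `[a, b] mab
  (fun n y => (\int[leb]_t (inversion_integrand P y t * w n t))%:E)
  (EFin \o (fun y => \int[leb]_t inversion_integrand P y t))
  (fun=> (\int[leb]_t G t)%:E).
- move=> n; apply/measurable_EFinP; apply: measurable_funTS.
  apply: continuous_measurable_fun.
  exact: (continuous_weighted_integral (mw n) (w1 n)).
- exact: measurable_int iI.
- apply: aeW => y _; apply: cvg_EFin; first exact: nearW.
  exact: integral_w_cvg.
- by apply: iab => y; exact: cvg_cst.
- apply: aeW => y n _; rewrite lee_fin.
  exact: (normr_weighted_integral_le (mw n) (w1 n)).
- by move=> _ _.
Qed.

End integrable_charfun.
End inversion_theorem.

(** * Measures given by densities *)

Section density.
Context {R : realType}.
Local Notation T := (measurableTypeR R).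
Local Notation leb := (@lebesgue_measure R).

(** The measure with density [q] with respect to Lebesgue measure. The proofs
    [mq] and [q_ge0] are parameters so that it has a canonical measure
    structure. *)
Definition density_measure (q : R -> R) (mq : measurable_fun [set: T] q)
    (q_ge0 : forall x, 0 <= q x) (A : set T) : \bar R :=
  (\int[leb]_(x in A) (q x)%:E)%E.

Section density_measure_is_measure.
Variables (q : R -> R) (mq : measurable_fun [set: T] q)
  (q_ge0 : forall x, 0 <= q x).

Let density_measure0 : density_measure mq q_ge0 set0 = 0%E.
Proof. exact: integral_set0. Qed.

Let density_measure_ge0 A : (0 <= density_measure mq q_ge0 A)%E.
Proof. by apply: integral_ge0 => x _; rewrite lee_fin. Qed.

Let density_measure_sigma_additive : semi_sigma_additive (density_measure mq q_ge0).
Proof.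
move=> F mF tF mUF; rewrite /density_measure ge0_integral_bigcup//; last 2 first.
  by apply: measurable_funTS; exact/measurable_EFinP.
  by move=> x _; rewrite lee_fin.
by apply: is_cvg_ereal_nneg_natsum => n _; exact: density_measure_ge0.
Qed.

HB.instance Definition _ := isMeasure.Build _ _ _ (density_measure mq q_ge0)
  density_measure0 density_measure_ge0 density_measure_sigma_additive.

End density_measure_is_measure.

(** The same measure, with a proof that its total mass is 1. *)
Definition density_probability (q : R -> R) (mq : measurable_fun [set: T] q)
    (q_ge0 : forall x, 0 <= q x) (q1 : (\int[leb]_x (q x)%:E = 1)%E) :=
  density_measure mq q_ge0.

HB.instance Definition _ q mq q_ge0 q1 :=
  Measure.on (@density_probability q mq q_ge0 q1).

HB.instance Definition _ q mq q_ge0 q1 :=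
  Measure_isProbability.Build _ _ _ (@density_probability q mq q_ge0 q1) q1.

Lemma density_dominates (P : probability T R) (f : R -> R) :
  is_density P f -> P `<< leb.
Proof.
move=> [mf f0 Pf]; apply/null_content_dominatesP => A mA A0.
by rewrite Pf// null_set_integral//; apply: measurable_funTS; exact/measurable_EFinP.
Qed.

Lemma integral_density (P : probability T R) (f : R -> R) (h : T -> \bar R) :
  is_density P f -> P.-integrable setT h ->
  (\int[P]_x h x = \int[leb]_x (h x * (f x)%:E))%E.
Proof.
move=> Pf ih; have Pleb := density_dominates Pf; case: Pf => mf f0 Pf.
rewrite -(Radon_Nikodym_change_of_variables Pleb measurableT ih).
have mh := measurable_int _ ih.
have mRN : measurable_fun [set: T] (Radon_Nikodym (charge_of_finite_measure P) leb).
  exact: measurable_int (Radon_Nikodym_integrable _).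
have mf' : measurable_fun [set: T] (EFin \o f) by exact/measurable_EFinP.
apply: ae_eq_integral => //; [exact: emeasurable_funM..|].
apply: ae_eqe_mul2l.
apply: integral_ae_eq => //; first exact: Radon_Nikodym_integrable.
by move=> A _ mA; rewrite -Radon_Nikodym_integral//; exact: Pf.
Qed.

Lemma Rintegral_density (P : probability T R) (f h : R -> R) (C : R) :
  is_density P f -> measurable_fun [set: T] h -> (forall x, `|h x| <= C) ->
  \int[P]_x h x = \int[leb]_x (h x * f x).
Proof.
move=> Pf mh hC; rewrite /Rintegral (integral_density Pf)//.
exact: bounded_integrable hC.
Qed.

Lemma eq_Rintegral_ae (u v : R -> R) :
  measurable_fun [set: T] u -> measurable_fun [set: T] v ->
  {ae leb, forall x : T, u x = v x} -> \int[leb]_x u x = \int[leb]_x v x.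
Proof.
move=> mu_ mv uv; congr fine; apply: ae_eq_integral => //; try exact/measurable_EFinP.
by move: uv; apply: filterS => x /= -> _.
Qed.

Lemma measurable_prod_fun (I : eqType) (s : seq I) (p : pred I) (u : I -> R -> R) :
  (forall i, measurable_fun [set: T] (u i)) ->
  measurable_fun [set: T] (fun x => \prod_(i <- s | p i) u i x).
Proof.
move=> mu_; under eq_fun do rewrite big_mkcond/=.
apply: (measurable_prod (h := fun i x => if p i then u i x else 1)) => i _.
by case: (p i); [exact: mu_|exact: measurable_cst].
Qed.

Lemma Rintegral_near_cst (g : R -> R) (a b c e : R) : continuous g -> a <= b ->
  (forall y, a <= y <= b -> `|g y - c| <= e) ->
  `|\int[leb]_(y in `[a, b]) g y - c * (b - a)| <= e * (b - a).
Proof.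
move=> cg ab gc.
have mab : measurable (`[a, b]%classic : set T) by exact: measurable_itv.
have iab (h : R -> R) : continuous h -> leb.-integrable `[a, b] (EFin \o h).
  move=> ch; apply: continuous_compact_integrable; first exact: segment_compact.
  exact: continuous_subspaceT.
have icst (k : R) : leb.-integrable `[a, b] (EFin \o (fun=> k)).
  by apply: iab => y; exact: cvg_cst.
have lab (k : R) : \int[leb]_(y in `[a, b]) k = k * (b - a).
  rewrite Rintegral_cst//= lebesgue_measure_itv/= lte_fin.
  by case: ltgtP ab => // -> _; rewrite subrr mulr0.
rewrite -lab -lab -RintegralB//; last exact: iab.
apply: (le_trans (le_normr_Rintegral _ _)) => //.
  by have := integrableB mab (iab _ cg) (icst c).
apply: le_Rintegral => //.
by apply: integrable_norm; have := integrableB mab (iab _ cg) (icst c).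
Qed.

End density.

(** * Averages over dyadic cells *)

Section dyadic_cells.
Context {R : realType}.
Local Notation T := (measurableTypeR R).
Local Notation leb := (@lebesgue_measure R).
Implicit Types (P : probability T R) (x : R) (j : nat) (k : int).

(** The half-open dyadic interval of level [j] with right endpoint [k / 2 ^ j]. *)
Definition dyadic_cell j k : set T := `](dyadic R (k - 1) j), (dyadic R k j)]%classic.

(** The index of the cell of level [j] that contains [x]. *)
Definition cell_index j x : int := Num.ceil (x * 2 ^+ j).

Lemma dyadic_cellP j k x : dyadic_cell j k x <-> cell_index j x = k.
Proof.
rewrite /dyadic_cell /= in_itv/= /dyadic ltr_pdivrMr ?exprn_gt0//.
rewrite ler_pdivlMr ?exprn_gt0// -ceil_eq; split => [/eqP//|<-].
exact: eqxx.
Qed.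

Lemma measurable_dyadic_cell j k : measurable (dyadic_cell j k).
Proof. exact: measurable_itv. Qed.

Lemma dyadic_cell_length j k : dyadic R k j - dyadic R (k - 1) j = 2^-1 ^+ j.
Proof. by rewrite /dyadic -mulrBl intrD rmorphN1 opprB addrC subrK mul1r exprVn. Qed.

Lemma dyadic_cell_lt j k : dyadic R (k - 1) j < dyadic R k j.
Proof. by rewrite -subr_gt0 dyadic_cell_length exprn_gt0// invr_gt0. Qed.

Lemma cell_index_in j x : dyadic_cell j (cell_index j x) x.
Proof. exact/dyadic_cellP. Qed.

Lemma cell_index_near j x : `|dyadic R (cell_index j x) j - x| <= 2^-1 ^+ j.
Proof.
have := cell_index_in j x; rewrite /dyadic_cell /= in_itv/=.
have := dyadic_cell_length j (cell_index j x).
move=> H /andP[xl xr]; rewrite ler_norml; lra.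
Qed.

Lemma cvg_half_exp : (2^-1 : R) ^+ j @[j --> \oo] --> (0 : R).
Proof. by apply: cvg_expr; rewrite ger0_norm ?invf_lt1// ltr1n. Qed.

Lemma cell_index_cvg x : dyadic R (cell_index j x) j @[j --> \oo] --> x.
Proof.
apply/cvgrPdist_le => e e0.
have /cvgr0Pnorm_le/(_ _ e0) := cvg_half_exp.
apply: filterS => j; rewrite ger0_norm ?exprn_ge0 ?invr_ge0// distrC.
exact: le_trans (cell_index_near j x).
Qed.

(** The mean density of [P] on the cell of level [j] that contains [x]. *)
Definition cell_average P j x : R :=
  2 ^+ j * fine (P (dyadic_cell j (cell_index j x))).

Lemma cell_average_ge0 P j x : 0 <= cell_average P j x.
Proof. by rewrite mulr_ge0 ?exprn_ge0// fine_ge0. Qed.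

Section continuous_density.
Variables (P : probability T R) (g : R -> R).
Hypotheses (cg : continuous g)
  (Pg : forall a b, a < b -> P `]a, b]%classic = (\int[leb]_(y in `[a, b]) g y)%:E).

Let cell_average_near j x c e :
  (forall y, dyadic R (cell_index j x - 1) j <= y <= dyadic R (cell_index j x) j ->
    `|g y - c| <= e) ->
  `|cell_average P j x - c| <= e.
Proof.
move=> H; rewrite /cell_average Pg ?dyadic_cell_lt//=.
have := Rintegral_near_cst cg (ltW (dyadic_cell_lt j (cell_index j x))) H.
rewrite dyadic_cell_length exprVn -ler_pdivrMr ?invr_gt0 ?exprn_gt0// invrK.
rewrite -[X in _ * X](@ger0_norm _ (2 ^+ j)) ?exprn_ge0// -normrM mulrBl mulrVK.
  by rewrite (mulrC (2 ^+ j)).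
by rewrite unitfE expf_neq0.
Qed.

Lemma cell_average_le M j x : (forall y, `|g y| <= M) -> `|cell_average P j x| <= M.
Proof.
move=> gM; rewrite -[X in `|X|]subr0; apply: cell_average_near => y _.
by rewrite subr0.
Qed.

Lemma cell_average_cvg x : cell_average P j x @[j --> \oo] --> g x.
Proof.
apply/cvgrPdist_le => e e0.
have /cvgrPdist_le/(_ _ e0)/nbhs_ballP[d /= d0 xd] := @cg x.
have /cvgr0Pnorm_lt/(_ _ d0) := cvg_half_exp.
apply: filterS => j; rewrite ger0_norm ?exprn_ge0 ?invr_ge0// => jd.
rewrite distrC; apply: cell_average_near => y /andP[yl yr].
rewrite distrC; apply: xd; rewrite /ball/=.
have := cell_index_in j x; rewrite /dyadic_cell /= in_itv/=.
have := dyadic_cell_length j (cell_index j x).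
move=> H /andP[xl xr]; rewrite ltr_norml; lra.
Qed.

(** A limit of cell averages, which are nonnegative. *)
Lemma continuous_density_ge0 x : 0 <= g x.
Proof.
apply: (cvgr_to_ge (cell_average_cvg (x := x))).
by apply: nearW => j; exact: cell_average_ge0.
Qed.

Lemma continuous_density_integral (A : set T) : measurable A ->
  P A = (\int[leb]_(x in A) (g x)%:E)%E.
Proof.
have mg : measurable_fun [set: T] g by exact: continuous_measurable_fun.
apply: (@eq_measure_ocitv _ P (density_measure mg continuous_density_ge0)).
- move=> a b ab; apply: (etrans (Pg ab)); rewrite /= /density_measure integral_itv_obnd_cbnd//.
    have iab : leb.-integrable `[a, b] (EFin \o g).
      apply: continuous_compact_integrable; first exact: segment_compact.
      exact: continuous_subspaceT.
    by rewrite /Rintegral fineK//; exact: integrable_fin_num iab.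
  by apply: measurable_funTS; exact/measurable_EFinP.
- by rewrite -ge0_fin_numE//; exact: fin_num_measure.
Qed.

Lemma density_ae_continuous f : is_density P f -> {ae leb, forall x : T, f x = g x}.
Proof.
move=> [mf f0 Pf].
have mg : measurable_fun [set: T] g by exact: continuous_measurable_fun.
have : ae_eq leb setT (EFin \o f) (EFin \o g).
  apply: integral_ae_eq => //.
  - apply/integrableP; split; first exact/measurable_EFinP.
    under eq_integral do rewrite /= ger0_norm//.
    by rewrite -Pf// -ge0_fin_numE//; exact: fin_num_measure.
  - exact/measurable_EFinP.
  - by move=> A _ mA; rewrite -Pf// continuous_density_integral.
by apply: filterS => x /= /(_ I) [].
Qed.

End continuous_density.

End dyadic_cells.

(** * Integrals against dyadic conflations *)

Section conflation_integral.
Context {R : realType} (n : nat).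
Local Notation T := (measurableTypeR R).
Local Notation leb := (@lebesgue_measure R).
Variables (P : 'I_n -> probability T R) (i0 : 'I_n).
Implicit Types (x : R) (j : nat) (k : int).

(* An enumeration of the integers, since countable additivity of measures is
   stated for families indexed by [nat]. *)
Let int_of_nat (m : nat) : int := if odd m then Negz m./2 else Posz m./2.

Let int_of_nat_bij : set_bij [set: nat] [set: int] int_of_nat.
Proof.
split=> //.
- move=> a b _ _; rewrite /int_of_nat.
  case oa: (odd a); case ob: (odd b) => // -[ab];
    by rewrite -(odd_double_half a) -(odd_double_half b) oa ob ab.
- move=> [m|m] _.
    by exists m.*2 => //; rewrite /int_of_nat odd_double doubleK.
  by exists m.*2.+1 => //; rewrite /int_of_nat /= odd_double uphalf_double.
Qed.

Let int_of_nat_surj k : exists m, int_of_nat m = k.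
Proof. by have [_ _ /(_ k I)[m _ <-]] := int_of_nat_bij; exists m. Qed.

Let int_of_nat_inj a b : int_of_nat a = int_of_nat b -> a = b.
Proof. by have [_ H _] := int_of_nat_bij => /H; apply; rewrite inE. Qed.

Lemma measurable_comp_cell_index d (U : measurableType d) j (phi : int -> U) :
  measurable_fun [set: T] (fun x : T => phi (cell_index j (x : R))).
Proof.
move=> _ B mB; rewrite setTI.
rewrite [X in measurable X](_ : _ =
    \bigcup_(m in [set m | B (phi (int_of_nat m))]) dyadic_cell j (int_of_nat m)).
  by apply: bigcup_measurable => m _; exact: measurable_dyadic_cell.
apply/seteqP; split => [x /= Bx|x [m /= Bm /dyadic_cellP ->//]].
have [m mE] := int_of_nat_surj (cell_index j x).
by exists m; rewrite /= ?mE//; exact: cell_index_in.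
Qed.

(** The product of the masses that the [P i] with [i != i0] give to a cell. *)
Definition other_mass j k : R :=
  \prod_(i < n | i != i0) fine (P i (dyadic_cell j k)).

Lemma other_mass_ge0 j k : 0 <= other_mass j k.
Proof. by apply: prodr_ge0 => i _; exact: fine_ge0. Qed.

Lemma dyadic_weight_split j k :
  dyadic_weight P j k = ((other_mass j k)%:E * P i0 (dyadic_cell j k))%E.
Proof.
rewrite /dyadic_weight (bigD1 i0)//= muleC; congr (_ * _)%E.
rewrite /other_mass; elim/big_rec2 : _ => // i u v _ ->.
by rewrite EFinM fineK//; apply: fin_num_measure; exact: measurable_dyadic_cell.
Qed.

(** The dyadic conflation of level [j] is the image, under rounding up to the grid
    of level [j], of [P i0] reweighted by [other_mass]: both sides are the same
    sum over the cells. *)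
Lemma ge0_integral_dyadic_conflation j (h : T -> \bar R) :
  measurable_fun setT h -> (forall x, 0 <= h x)%E ->
  (\int[dyadic_conflation P j]_x h x =
   \int[P i0]_x (h (dyadic R (cell_index j x) j : T) *
     (other_mass j (cell_index j x))%:E))%E.
Proof.
move=> mh h0.
have w0 k : 0 <= fine (dyadic_weight P j k).
  by rewrite fine_ge0// dyadic_weight_ge0.
pose m_ i := mscale (NngNum (w0 (int_of_nat i)))
  (dirac (dyadic R (int_of_nat i) j : T)).
have -> : (\int[dyadic_conflation P j]_x h x = \int[mseries m_ 0]_x h x)%E.
  apply: eq_measure_integral => A mA _; rewrite /= /dyadic_conflation.
  rewrite (@reindex_esum _ _ _ _ _ int_of_nat _ int_of_nat_bij) /mseries nneseries_esumT//.
  apply: eq_esum => i _.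
  by rewrite -[in LHS](fineK (dyadic_weight_fin_num P j (int_of_nat i))).
rewrite ge0_integral_measure_series//.
transitivity (\sum_(i <oo)
    (dyadic_weight P j (int_of_nat i) * h (dyadic R (int_of_nat i) j : T)))%E.
  apply: eq_eseriesr => i _; rewrite ge0_integral_mscale//.
  by rewrite integral_dirac// diracT mul1e/= fineK ?dyadic_weight_fin_num.
have -> : [set: T] = \bigcup_i dyadic_cell j (int_of_nat i).
  apply/seteqP; split => // x _.
  have [m mE] := int_of_nat_surj (cell_index j x).
  by exists m => //; rewrite mE; exact: cell_index_in.
rewrite ge0_integral_bigcup//; last 4 first.
- by move=> i; exact: measurable_dyadic_cell.
- apply: measurable_funTS.
  exact: (measurable_comp_cell_index j (fun k => h (dyadic R k j : T) * (other_mass j k)%:E)%E).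
- by move=> x _; rewrite mule_ge0// lee_fin other_mass_ge0.
- apply/trivIsetP => a b _ _ /eqP ab; rewrite -subset0 => x [/dyadic_cellP xa /dyadic_cellP xb].
  by apply: ab; apply: int_of_nat_inj; rewrite -xa -xb.
apply: eq_eseriesr => i _.
transitivity (\int[P i0]_(x in dyadic_cell j (int_of_nat i))
   (cst (h (dyadic R (int_of_nat i) j : T) * (other_mass j (int_of_nat i))%:E) x))%E.
  rewrite integral_cst; last exact: measurable_dyadic_cell.
  by rewrite dyadic_weight_split muleC muleA.
by apply: eq_integral => x; rewrite inE => /dyadic_cellP ->.
Qed.

End conflation_integral.

(** * Limits of dyadic conflations *)

Section conflation_limit.
Context {R : realType} (n : nat).
Local Notation T := (measurableTypeR R).
Local Notation leb := (@lebesgue_measure R).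
Variables (P : 'I_n -> probability T R) (i0 : 'I_n).
Implicit Types (x : R) (j : nat) (k : int).

Lemma other_mass_le1 j k : other_mass P i0 j k <= 1.
Proof.
rewrite /other_mass; apply: prodr_ile1 => i _; rewrite fine_ge0//=.
rewrite -lee_fin fineK; first exact: probability_le1 (measurable_dyadic_cell _ _).
by apply: fin_num_measure; exact: measurable_dyadic_cell.
Qed.

Let measurable_discretized j (h : R -> R) :
  measurable_fun [set: T] (fun x : T => h (dyadic R (cell_index j (x : R)) j)
    * other_mass P i0 j (cell_index j (x : R))).
Proof.
exact: (measurable_comp_cell_index j
  (fun k => h (dyadic R k j) * other_mass P i0 j k)).
Qed.

Let normr_discretized_le j (h : R -> R) (C : R) x : (forall x, `|h x| <= C) ->
  `|h (dyadic R (cell_index j x) j) * other_mass P i0 j (cell_index j x)| <= C.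
Proof.
move=> hC; rewrite normrM (ger0_norm (other_mass_ge0 _ _ _ _)).
rewrite -[leRHS]mulr1 ler_pM// ?other_mass_le1 ?other_mass_ge0//.
Qed.

Lemma dyadic_conflation_lty j : (dyadic_conflation P j setT < +oo)%E.
Proof.
have : (\int[dyadic_conflation P j]_x (cst 1%E x) < +oo)%E.
  rewrite (ge0_integral_dyadic_conflation P i0)//.
  apply: (@le_lt_trans _ _ (\int[P i0]_x (cst 1%E x))%E).
    apply: ge0_le_integral => //.
    - by move=> x _; rewrite mul1e lee_fin other_mass_ge0.
    - exact: (measurable_comp_cell_index j (fun k => 1 * (other_mass P i0 j k)%:E)%E).
    - by move=> x _; rewrite mul1e lee_fin other_mass_le1.
  by rewrite integral_cst// mul1e -ge0_fin_numE//; exact: fin_num_measure.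
by rewrite integral_cst// mul1e.
Qed.

Lemma integrable_dyadic_conflation j (h : R -> R) (C : R) :
  measurable_fun [set: T] h -> (forall x, `|h x| <= C) ->
  (dyadic_conflation P j).-integrable setT (EFin \o h).
Proof.
move=> mh hC; apply: measurable_bounded_integrable => //.
  exact: dyadic_conflation_lty.
exists C; split; first exact: num_real.
by move=> M CM x _; exact: le_trans (hC x) (ltW CM).
Qed.

(** Signed version, obtained by adding the constant [C] to make [h]
    nonnegative. *)
Lemma Rintegral_dyadic_conflation j (h : R -> R) (C : R) :
  measurable_fun [set: T] h -> (forall x, `|h x| <= C) ->
  \int[dyadic_conflation P j]_x h x =
  \int[P i0]_x (h (dyadic R (cell_index j x) j) *
     other_mass P i0 j (cell_index j x)).
Proof.
move=> mh hC.
have C0 : 0 <= C by rewrite (le_trans _ (hC 0)).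
have mhC : measurable_fun [set: T] (fun x => h x + C) by exact: measurable_funD.
have hC0 x : 0 <= h x + C by move: (hC x); rewrite ler_norml => /andP[]; lra.
have hC2 x : `|h x + C| <= C + C.
  by rewrite (le_trans (ler_normD _ _))// (ger0_norm C0) lerD2r.
have CC x : `|C| <= C by rewrite ger0_norm.
have H (u : R -> R) : measurable_fun [set: T] u -> (forall x, 0 <= u x) ->
    \int[dyadic_conflation P j]_x u x =
    \int[P i0]_x (u (dyadic R (cell_index j x) j) *
       other_mass P i0 j (cell_index j x)).
  move=> mu0 u0; rewrite /Rintegral (ge0_integral_dyadic_conflation P i0)//.
  exact/measurable_EFinP.
transitivity (\int[dyadic_conflation P j]_x ((h x + C) - C)).
  by apply: eq_Rintegral => x _; rewrite addrK.
have iC : (dyadic_conflation P j).-integrable setT (EFin \o (fun=> C)).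
  exact: (@integrable_dyadic_conflation _ (fun=> C) C).
apply: (etrans (RintegralB measurableT
  (integrable_dyadic_conflation j mhC hC2) iC)).
rewrite !H//.
have i1 := bounded_integrable (P i0)
  (measurable_discretized j (fun x => h x + C))
  (fun x => normr_discretized_le j x hC2).
have i2 := bounded_integrable (P i0)
  (measurable_discretized j (fun=> C))
  (fun x => @normr_discretized_le j (fun=> C) C x CC).
apply: (etrans (esym (RintegralB measurableT i1 i2))).
by apply: eq_Rintegral => x _; rewrite -mulrBl addrK.
Qed.

Section limit.
Variables (g : 'I_n -> R -> R) (M : 'I_n -> R).
Hypotheses (cg : forall i, continuous (g i))
  (Pg : forall i a b, a < b ->
    P i `]a, b]%classic = (\int[leb]_(y in `[a, b]) g i y)%:E)
  (gM : forall i y, `|g i y| <= M i).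

Let scaled_other_mass j x : (2 ^+ j) ^+ n.-1 * other_mass P i0 j (cell_index j x) =
  \prod_(i < n | i != i0) cell_average (P i) j x.
Proof.
rewrite /cell_average big_split/= prodr_const cardC1 card_ord.
by rewrite /other_mass.
Qed.

Let cvg_prod_average x : \prod_(i < n | i != i0) cell_average (P i) j x @[j --> \oo] -->
   \prod_(i < n | i != i0) g i x.
Proof.
elim: (index_enum _) => [|i s IH].
  rewrite big_nil; under eq_fun do rewrite big_nil; exact: cvg_cst.
rewrite big_cons; under eq_fun do rewrite big_cons.
case: ifPn => // _; apply: cvgM => //.
exact: (@cell_average_cvg _ (P i) (g i) (@cg i) (@Pg i) x).
Qed.

(** By dominated convergence with respect to [P i0]: each cell average converges
    to a continuous density and is bounded by the bound of that density. *)
Lemma conflation_cvg (h : R -> R) (C : R) : continuous h -> (forall x, `|h x| <= C) ->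
  (2 ^+ j) ^+ n.-1 * \int[dyadic_conflation P j]_x h x @[j --> \oo] -->
  \int[P i0]_x (h x * \prod_(i < n | i != i0) g i x).
Proof.
move=> ch hC.
have mh : measurable_fun [set: T] h by exact: continuous_measurable_fun.
pose F j x := h (dyadic R (cell_index j x) j) *
   \prod_(i < n | i != i0) cell_average (P i) j x.
have FE j : (2 ^+ j) ^+ n.-1 * \int[dyadic_conflation P j]_x h x = \int[P i0]_x F j x.
  rewrite (Rintegral_dyadic_conflation j mh hC) -RintegralZl//; last first.
    apply: (@bounded_integrable R (P i0) _ C).
      exact: (measurable_discretized j h).
    by move=> x; exact: (normr_discretized_le j x hC).
  by apply: eq_Rintegral => x _; rewrite /F -scaled_other_mass mulrCA.
rewrite (_ : (fun j => _) = (fun j => \int[P i0]_x F j x)); last exact/funext.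
have mF j : measurable_fun [set: T] (F j).
  exact: (measurable_comp_cell_index j (fun k => h (dyadic R k j) *
    \prod_(i < n | i != i0) (2 ^+ j * fine (P i (dyadic_cell j k))))).
have C0 : 0 <= C by rewrite (le_trans _ (hC 0)).
pose B := C * \prod_(i < n | i != i0) M i.
have prodM (u : 'I_n -> R) : (forall i, `|u i| <= M i) ->
  `|\prod_(i < n | i != i0) u i| <= \prod_(i < n | i != i0) M i.
  by move=> uM; rewrite normr_prod; apply: ler_prod => i _; rewrite normr_ge0/=.
have FB j x : `|F j x| <= B.
  rewrite normrM ler_pM//; apply: prodM => i.
  exact: (@cell_average_le _ (P i) (g i) (@cg i) (@Pg i)).
have mlim : measurable_fun [set: T] (fun x => h x * \prod_(i < n | i != i0) g i x).
  apply: measurable_funM => //; apply: measurable_prod_fun => i.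
  exact: continuous_measurable_fun.
have ilim : (P i0).-integrable setT
    (EFin \o (fun x => h x * \prod_(i < n | i != i0) g i x)).
  apply: (@bounded_integrable R (P i0) _ B) => // x.
  by rewrite normrM ler_pM//; exact: prodM.
apply: fine_cvg.
rewrite fineK; last exact: integrable_fin_num ilim.
have [] := @dominated_convergence _ T R (P i0) setT measurableT
  (fun j x => (F j x)%:E)
  (EFin \o (fun x => h x * \prod_(i < n | i != i0) g i x)) (fun=> B%:E).
- by move=> j; exact/measurable_EFinP.
- exact/measurable_EFinP.
- apply: aeW => x _; apply: cvg_EFin; first exact: nearW.
  have h1 : h (dyadic R (cell_index j x) j) @[j --> \oo] --> h x.
    apply: (cvg_comp (fun j => dyadic R (cell_index j x) j) h); last exact: ch.
    exact: cell_index_cvg.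
  have h2 : F j x @[j --> \oo] --> h x * \prod_(i < n | i != i0) g i x.
    by apply: cvgM; [exact: h1|exact: cvg_prod_average].
  exact: h2.
- exact: integrable_cst_finite.
- by apply: aeW => x j _; rewrite lee_fin.
- by move=> _ _.
Qed.

End limit.
End conflation_limit.

(** * Convolutions of characteristic functions *)

Section fourier_transform.
Context {R : realType}.
Local Notation T := (measurableTypeR R).
Local Notation leb := (@lebesgue_measure R).
Implicit Types (x t s : R).

Lemma lebesgue_measure_opp (A : set T) : measurable A ->
  leb (-%R @^-1` A) = leb A.
Proof.
have mN : measurable_fun [set: T] (-%R : T -> T) by exact: oppr_measurable.
pose N : {mfun T >-> T} := HB.pack (-%R : T -> T) (isMeasurableFun.Build _ _ _ _ _ mN).
move=> mA; apply/esym; apply: (@lebesgue_measure_unique R (pushforward leb N)) => //.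
move=> _ [[a b] _ <-] /=.
rewrite /pushforward/= [X in _ = leb X](_ : _ = `[(- b), (- a)[%classic).
  rewrite !lebesgue_measure_itv/= !lte_fin ltrN2.
  by case: ifPn => // _; rewrite -!EFinB opprK addrC.
by apply/seteqP; split => x /=; rewrite !in_itv/= lerNl ltrNr => /andP[-> ->].
Qed.

Lemma Rintegral_odd (f : R -> R) : leb.-integrable setT (EFin \o f) ->
  (forall x, f (- x) = - f x) -> \int[leb]_x f x = 0.
Proof.
move=> intf oddf.
have mN : measurable_fun [set: T] (-%R : T -> T) by exact: oppr_measurable.
pose N : {mfun T >-> T} := HB.pack (-%R : T -> T) (isMeasurableFun.Build _ _ _ _ _ mN).
have intfN : leb.-integrable setT ((EFin \o f) \o N).
  have := integrableN intf.
  by apply: eq_integrable => // x _ /=; rewrite oddf.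
have : \int[leb]_x f x = \int[leb]_x f (- x).
  rewrite /Rintegral; congr fine.
  have := @integral_pushforward _ _ T T R N (measurable_funPT N) leb setT
    (EFin \o f) (measurable_int _ intf) intfN measurableT.
  rewrite preimage_setT /= => <-.
  apply: eq_measure_integral => A mA _.
  exact: esym (lebesgue_measure_opp mA).
have -> : \int[leb]_x f (- x) = - \int[leb]_x f x.
  rewrite -[RHS]mulN1r -RintegralZl//.
  by apply: eq_Rintegral => x _; rewrite oddf mulN1r.
lra.
Qed.

(** The Fourier transform of a real function, with the sign convention of
    characteristic functions. *)
Definition fourier (G : R -> R) t : R[i] :=
  (\int[leb]_x (G x * cos (t * x))) +i* (\int[leb]_x (G x * sin (t * x))).

Section convolution_charfun.
Variable P : probability T R.
Hypothesis psiL1 : Cintegrable leb (charfun P).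
Local Notation rpsi := (fun t => complex.Re (charfun P t)).
Local Notation ipsi := (fun t => complex.Im (charfun P t)).

Let Re_charfunN s : rpsi (- s) = rpsi s.
Proof. by apply: eq_Rintegral => x _ /=; rewrite mulNr cosN. Qed.

Let Im_charfunN s : ipsi (- s) = - ipsi s.
Proof.
rewrite /charfun /= -[RHS]mulN1r -(RintegralZl _ measurableT (integrable_sin P s)).
by apply: eq_Rintegral => x _ /=; rewrite mulNr sinN mulN1r.
Qed.

Let irpsi := integrable_Re_charfun psiL1.
Let iipsi := integrable_Im_charfun psiL1.

Let sin_mul_integrable x (u : R -> R) : leb.-integrable setT (EFin \o u) ->
  leb.-integrable setT (EFin \o (fun s => sin (s * x) * u s)).
Proof.
move=> iu.
have mk : measurable_fun [set: T * T] (fun z => sin (z.2 * z.1) : R).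
  apply: (measurableT_comp measurable_sin); apply: measurable_funM.
    exact: measurable_snd.
  exact: measurable_fst.
have := @integrable_kernel R leb u (fun x s => sin (s * x)) 1 iu mk
  (fun x s => normr_sin_le1 _) x.
exact.
Qed.

Let cos_mul_integrable x (u : R -> R) : leb.-integrable setT (EFin \o u) ->
  leb.-integrable setT (EFin \o (fun s => cos (s * x) * u s)).
Proof.
move=> iu.
have mk : measurable_fun [set: T * T] (fun z => cos (z.2 * z.1) : R).
  apply: (measurableT_comp measurable_cos); apply: measurable_funM.
    exact: measurable_snd.
  exact: measurable_fst.
have := @integrable_kernel R leb u (fun x s => cos (s * x)) 1 iu mk
  (fun x s => normr_cos_le1 _) x.
exact.
Qed.

(* Minus the imaginary part of [charfun P s * exp (- i s x)]. *)
Let odd_integrand x s := sin (s * x) * rpsi s - cos (s * x) * ipsi s.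

Let integrable_odd x : leb.-integrable setT (EFin \o odd_integrand x).
Proof.
have := integrableB measurableT (sin_mul_integrable x irpsi)
  (cos_mul_integrable x iipsi).
exact: eq_integrable.
Qed.

Let integral_odd x : \int[leb]_s odd_integrand x s = 0.
Proof.
apply: Rintegral_odd; first exact: integrable_odd.
move=> s; rewrite /odd_integrand Re_charfunN Im_charfunN mulNr sinN cosN.
by rewrite mulrN opprK mulNr opprB addrC.
Qed.

Let integral_inversion x :
  \int[leb]_s inversion_integrand P x s = 2 * pi * inversion_density P x.
Proof.
rewrite /inversion_density mulrA divff ?mul1r//.
by rewrite mulf_neq0// gt_eqF// pi_gt0.
Qed.

Let integral_combination x (a b : R) :
  \int[leb]_s (a * inversion_integrand P x s + b * odd_integrand x s) =
  2 * pi * inversion_density P x * a.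
Proof.
have i1 := integrable_inversion_integrand psiL1 x.
have i1' : leb.-integrable setT (EFin \o (fun s => a * inversion_integrand P x s)).
  by have := integrableZl measurableT a i1; apply: eq_integrable.
have i2' : leb.-integrable setT (EFin \o (fun s => b * odd_integrand x s)).
  by have := integrableZl measurableT b (integrable_odd x); apply: eq_integrable.
rewrite (RintegralD measurableT i1' i2').
rewrite (RintegralZl _ measurableT i1) (RintegralZl _ measurableT (integrable_odd x)).
by rewrite integral_odd mulr0 addr0 integral_inversion mulrC.
Qed.

Variable G : R -> R.
Hypothesis iG : leb.-integrable setT (EFin \o G).

Let mcos t : measurable_fun [set: T * T] (fun z => cos ((t - z.2) * z.1) : R).
Proof.
apply: (measurableT_comp measurable_cos); apply: measurable_funM.
  by apply: measurable_funB => //; exact: measurable_snd.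
exact: measurable_fst.
Qed.

Let msin t : measurable_fun [set: T * T] (fun z => sin ((t - z.2) * z.1) : R).
Proof.
apply: (measurableT_comp measurable_sin); apply: measurable_funM.
  by apply: measurable_funB => //; exact: measurable_snd.
exact: measurable_fst.
Qed.

Let swap2 t (u v : R -> R) :
  leb.-integrable setT (EFin \o u) -> leb.-integrable setT (EFin \o v) ->
  \int[leb]_s ((\int[leb]_x (G x * cos ((t - s) * x))) * u s +
               (\int[leb]_x (G x * sin ((t - s) * x))) * v s) =
  \int[leb]_x (G x * \int[leb]_s (cos ((t - s) * x) * u s + sin ((t - s) * x) * v s)).
Proof.
move=> iu iv.
have kc x s := normr_cos_le1 ((t - s) * x).
have ks x s := normr_sin_le1 ((t - s) * x).
rewrite (RintegralD measurableT (integrable_kernel_left iG iu (mcos t) kc)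
  (integrable_kernel_left iG iv (msin t) ks)).
rewrite (Rintegral_kernel_swap iG iu (mcos t) kc).
rewrite (Rintegral_kernel_swap iG iv (msin t) ks).
rewrite -(RintegralD measurableT (integrable_kernel_right iG iu (mcos t) kc)
  (integrable_kernel_right iG iv (msin t) ks)).
apply: eq_Rintegral => x _; rewrite -mulrDr; congr (_ * _).
by rewrite -(RintegralD measurableT (integrable_kernel iu (mcos t) kc x)
  (integrable_kernel iv (msin t) ks x)).
Qed.

(** Convolving with [charfun P] multiplies the original by [2 pi] times the
    density of [P], by Fubini's theorem and the inversion formula. *)
Lemma convolution_fourier t :
  convolution (fourier G) (charfun P) t =
  fourier (fun x => 2 * pi * (G x * inversion_density P x)) t.
Proof.
have iNipsi : leb.-integrable setT (EFin \o (fun s => - ipsi s)).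
  by have := integrableN iipsi; apply: eq_integrable.
rewrite /convolution /Cintegral /fourier; congr (_ +i* _).
- transitivity (\int[leb]_s
    ((\int[leb]_x (G x * cos ((t - s) * x))) * rpsi s +
     (\int[leb]_x (G x * sin ((t - s) * x))) * (- ipsi s))).
    by apply: eq_Rintegral => s _; case: (charfun P s) => u v /=; rewrite mulrN.
  rewrite swap2//; apply: eq_Rintegral => x _.
  transitivity (G x * (2 * pi * inversion_density P x * cos (t * x))); last by ring.
  congr (_ * _); rewrite -(integral_combination x _ (sin (t * x))).
  apply: eq_Rintegral => s _; rewrite /inversion_integrand /odd_integrand.
  by rewrite mulrBl cosB sinB; ring.
- transitivity (\int[leb]_s
    ((\int[leb]_x (G x * cos ((t - s) * x))) * ipsi s +
     (\int[leb]_x (G x * sin ((t - s) * x))) * rpsi s)).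
    by apply: eq_Rintegral => s _; case: (charfun P s) => u v /=.
  rewrite swap2//; apply: eq_Rintegral => x _.
  transitivity (G x * (2 * pi * inversion_density P x * sin (t * x))); last by ring.
  congr (_ * _); rewrite -(integral_combination x _ (- cos (t * x))).
  apply: eq_Rintegral => s _; rewrite /inversion_integrand /odd_integrand.
  by rewrite mulrBl cosB sinB; ring.
Qed.

End convolution_charfun.
End fourier_transform.

(** * Existence and characteristic function of the conflation *)

Section vague_convergence.
Context {R : realType}.
Local Notation T := (measurableTypeR R).

Lemma continuous_vanishing_bounded (h : R -> R) : continuous h ->
  h x @[x --> +oo] --> (0 : R) -> h x @[x --> -oo] --> (0 : R) ->
  exists C, forall x, `|h x| <= C.
Proof.
move=> ch /cvgr0Pnorm_le/(_ _ ltr01)[A [_ hA]] /cvgr0Pnorm_le/(_ _ ltr01)[B [_ hB]].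
pose b := Num.max A B + 1; pose a := Num.min A B - 1.
have Ab : A < b by rewrite /b ltr_pwDr// le_max lexx.
have aB : a < B by rewrite /a ltrBlDr ltr_pwDr// ge_min lexx orbT.
have ab : a <= b.
  rewrite /a /b (@le_trans _ _ A)//; last by rewrite ltW.
  by rewrite lerBlDr ler_wpDr// ge_min lexx.
have cn : {within `[a, b], continuous (fun x => `|h x|)}.
  apply: continuous_subspaceT => x.
  by apply: (@continuous_comp _ _ _ h (fun y => `|y|)); [exact: ch|exact: norm_continuous].
have [c _ hc] := EVT_max ab cn.
exists (`|h c| + 1) => x.
have [xa|ax] := ltP x a.
  by rewrite (le_trans (hB _ _)) ?(lt_trans xa)// lerDr.
have [bx|xb] := ltP b x.
  by rewrite (le_trans (hA _ _)) ?(lt_trans _ bx)// lerDr.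
by rewrite ler_wpDr// hc// in_itv/= ax.
Qed.

Lemma integral_mnormalize (m : {measure set T -> \bar R}) (D : probability T R)
    (h : R -> R) : (0 < m setT)%E -> (m setT < +oo)%E ->
  m.-integrable setT (EFin \o h) ->
  (\int[mnormalize m D]_x (h x)%:E = ((\int[m]_x h x) / fine (m setT))%:E)%E.
Proof.
move=> m0 moo ih.
have mfin : m setT \is a fin_num by rewrite ge0_fin_numE.
have k0 : 0 <= (fine (m setT))^-1 by rewrite invr_ge0 fine_ge0.
have mh := measurable_int _ ih.
rewrite (eq_measure_integral (mscale (NngNum k0) m)); last first.
  move=> A mA _; rewrite /= /mnormalize /mscale/=.
  by rewrite gt_eqF// lt_eqF//= muleC.
rewrite integralE ge0_integral_mscale//; last exact: measurable_funepos.
rewrite ge0_integral_mscale//; last exact: measurable_funeneg.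
rewrite /= -muleBr//; last first.
  by rewrite fin_num_adde_defl// fin_numN integrable_neg_fin_num.
rewrite -integralE mulrC EFinM /Rintegral fineK//.
exact: integrable_fin_num ih.
Qed.

End vague_convergence.

Section conflation_of_densities.
Context {R : realType} (n : nat).
Local Notation T := (measurableTypeR R).
Local Notation leb := (@lebesgue_measure R).
Variables (P : 'I_n -> probability T R) (f : 'I_n -> R -> R).
Hypotheses (Pf : forall i, is_density (P i) (f i))
  (psiL1 : forall i, Cintegrable leb (charfun (P i))).

Local Notation g i := (inversion_density (P i)).

Let Pleb i : P i `<< leb. Proof. exact: density_dominates (Pf i). Qed.

Let cg i : continuous (g i).
Proof. exact: continuous_inversion_density (psiL1 i). Qed.

Let Pg i a b : a < b ->
  P i `]a, b]%classic = (\int[leb]_(y in `[a, b]) g i y)%:E.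
Proof. exact: (inversion_densityE (Pleb i) (psiL1 i)). Qed.

Lemma ae_density_inversion :
  {ae leb, forall x : T, forall i, f i x = g i x}.
Proof.
have H i : {ae leb, forall x : T, f i x = g i x}.
  exact: (density_ae_continuous (@cg i) (@Pg i) (Pf i)).
exact: (filter_forall _ H).
Qed.

Let mf i : measurable_fun [set: T] (f i). Proof. by case: (Pf i). Qed.

Let f0 i x : 0 <= f i x. Proof. by case: (Pf i). Qed.

Let mg i : measurable_fun [set: T] (g i).
Proof. exact: continuous_measurable_fun. Qed.

Let if_ i : leb.-integrable setT (EFin \o f i).
Proof.
apply/integrableP; split; first exact/measurable_EFinP.
under eq_integral do rewrite /= ger0_norm//.
have [_ _ Pfi] := Pf i.
by rewrite -Pfi// -ge0_fin_numE//; exact: fin_num_measure.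
Qed.

(** The function [G] is generalized so that the induction runs along the left
    fold. *)
Lemma foldl_convolution_fourier (s : seq 'I_n) (G : R -> R) :
  leb.-integrable setT (EFin \o G) ->
  foldl (@convolution R) (fourier G) [seq charfun (P i) | i <- s] =
  fourier (fun x => (2 * pi) ^+ size s * (G x * \prod_(i <- s) g i x)).
Proof.
elim: s G => [|i s IH] G iG /=.
  congr fourier; apply/funext => x.
  by rewrite expr0 mul1r big_nil mulr1.
have -> : convolution (fourier G) (charfun (P i)) =
    fourier (fun x => 2 * pi * (G x * g i x)).
  by apply/funext => t; exact: convolution_fourier.
rewrite IH.
  congr fourier; apply/funext => x.
  by rewrite big_cons exprS; ring.
have [M gM] := inversion_density_bounded (psiL1 i).
have bg : [bounded g i x | x in [set: T]].
  exists M; split; first exact: num_real.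
  by move=> N MN x _; exact: le_trans (gM x) (ltW MN).
have := integrableZl measurableT (2 * pi) (integrableMl measurableT iG (mg i) bg).
exact: eq_integrable.
Qed.

Lemma charfun_fourier i : charfun (P i) = fourier (f i).
Proof.
apply/funext => t; rewrite /charfun /Cintegral /fourier; congr (_ +i* _).
- rewrite (@Rintegral_density _ (P i) (f i) (fun x => cos (t * x)) 1)//.
  + by apply: eq_Rintegral => x _; rewrite mulrC.
  + by apply: (measurableT_comp measurable_cos); exact: measurable_funM.
  + by move=> x; exact: normr_cos_le1.
- rewrite (@Rintegral_density _ (P i) (f i) (fun x => sin (t * x)) 1)//.
  + by apply: eq_Rintegral => x _; rewrite mulrC.
  + by apply: (measurableT_comp measurable_sin); exact: measurable_funM.
  + by move=> x; exact: normr_sin_le1.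
Qed.

Lemma iter_convolution_charfun t : (0 < n)%N ->
  iter_convolution (fun i => charfun (P i)) t =
  fourier (fun x => (2 * pi) ^+ n.-1 * \prod_(i < n) f i x) t.
Proof.
move=> n0; rewrite /iter_convolution.
case E : (enum 'I_n) => [|i s] /=.
  by move/(congr1 size): E; rewrite size_enum_ord => En; rewrite En in n0.
have sn : size s = n.-1 by rewrite -[n in RHS](size_enum_ord n) E.
rewrite [charfun (P i)]charfun_fourier foldl_convolution_fourier// sn.
have mF (u : R -> R) : measurable_fun [set: T] u ->
    measurable_fun [set: T] (fun x =>
      (2 * pi) ^+ n.-1 * (f i x * \prod_(l <- s) g l x) * u x).
  move=> mu_; do 3 apply: measurable_funM => //.
  exact: measurable_prod_fun.
have mF' (u : R -> R) : measurable_fun [set: T] u ->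
    measurable_fun [set: T] (fun x =>
      (2 * pi) ^+ n.-1 * (\prod_(l < n) f l x) * u x).
  move=> mu_; do 2 apply: measurable_funM => //.
  exact: measurable_prod_fun.
have FE : {ae leb, forall x : T, f i x * \prod_(l <- s) g l x = \prod_(l < n) f l x}.
  move: ae_density_inversion; apply: filterS => x fg.
  rewrite -big_enum/= E big_cons; congr (_ * _).
  by apply: eq_bigr => l _; rewrite fg.
rewrite /fourier; congr (_ +i* _); apply: eq_Rintegral_ae.
- by apply: mF; apply: (measurableT_comp measurable_cos); exact: measurable_funM.
- by apply: mF'; apply: (measurableT_comp measurable_cos); exact: measurable_funM.
- by move: FE; apply: filterS => x ->.
- by apply: mF; apply: (measurableT_comp measurable_sin); exact: measurable_funM.
- by apply: mF'; apply: (measurableT_comp measurable_sin); exact: measurable_funM.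
- by move: FE; apply: filterS => x ->.
Qed.

Section conflation.
Hypotheses (n_gt0 : (0 < n)%N) (Pcompat : compatible P).
Hypotheses (I_gt0 : (0 < \int[leb]_x (\prod_(i < n) f i x)%:E)%E)
  (I_fin : (\int[leb]_x (\prod_(i < n) f i x)%:E < +oo)%E).

Let I := \int[leb]_x \prod_(i < n) f i x.

Let I0 : 0 < I.
Proof. by rewrite /I /Rintegral fine_gt0// I_gt0. Qed.

Let IE : (\int[leb]_x (\prod_(i < n) f i x)%:E)%E = I%:E.
Proof. by rewrite /I /Rintegral fineK// ge0_fin_numE// ltW. Qed.

Let prod_ge0 x : 0 <= \prod_(i < n) f i x.
Proof. by apply: prodr_ge0. Qed.

Let mprod : measurable_fun [set: T] (fun x => \prod_(i < n) f i x).
Proof. exact: measurable_prod_fun. Qed.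

(** The normalized product of the densities. *)
Definition conflation_density x := (\prod_(i < n) f i x) / I.

Lemma measurable_conflation_density : measurable_fun [set: T] conflation_density.
Proof. exact: measurable_funM. Qed.

Lemma conflation_density_ge0 x : 0 <= conflation_density x.
Proof. by rewrite divr_ge0// ltW. Qed.

Lemma conflation_density1 : (\int[leb]_x (conflation_density x)%:E = 1)%E.
Proof.
under eq_integral do rewrite /conflation_density EFinM.
rewrite ge0_integralZr//.
- by rewrite IE -EFinM divff// gt_eqF.
- exact/measurable_EFinP.
- by move=> x _; rewrite lee_fin.
- by rewrite lee_fin invr_ge0 ltW.
Qed.

(** The probability measure with that density. *)
Definition conflation_probability : probability T R :=
  density_probability measurable_conflation_density conflation_density_ge0
    conflation_density1.

Lemma conflation_is_density : is_density conflation_probability conflation_density.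
Proof.
split => //; [exact: measurable_conflation_density|exact: conflation_density_ge0].
Qed.

Let integrable_mul_prod (h : R -> R) (C : R) : measurable_fun [set: T] h ->
  (forall x, `|h x| <= C) ->
  leb.-integrable setT (EFin \o (fun x => h x * \prod_(i < n) f i x)).
Proof.
move=> mh hC.
have iprod : leb.-integrable setT (EFin \o (fun x => \prod_(i < n) f i x)).
  apply/integrableP; split; first exact/measurable_EFinP.
  by under eq_integral do rewrite /= ger0_norm//.
have bh : [bounded h x | x in [set: T]].
  exists C; split; first exact: num_real.
  by move=> N CN x _; exact: le_trans (hC x) (ltW CN).
by have := integrableMr measurableT mh bh iprod; apply: eq_integrable.
Qed.

Lemma Rintegral_conflation (h : R -> R) (C : R) : measurable_fun [set: T] h ->
  (forall x, `|h x| <= C) ->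
  \int[conflation_probability]_x h x =
  (\int[leb]_x (h x * \prod_(i < n) f i x)) / I.
Proof.
move=> mh hC; rewrite (Rintegral_density conflation_is_density mh hC).
rewrite -(RintegralZr _ measurableT (integrable_mul_prod mh hC)).
by apply: eq_Rintegral => x _; rewrite /conflation_density mulrA.
Qed.

Lemma charfun_conflation t : charfun conflation_probability t =
  iter_convolution (fun i => charfun (P i)) t / ((2 * pi) ^+ n.-1 * I)%:C.
Proof.
have mc : measurable_fun [set: T] (fun x => cos (t * x)).
  by apply: (measurableT_comp measurable_cos); exact: measurable_funM.
have ms : measurable_fun [set: T] (fun x => sin (t * x)).
  by apply: (measurableT_comp measurable_sin); exact: measurable_funM.
have c1 x := normr_cos_le1 (t * x).
have s1 x := normr_sin_le1 (t * x).
have K0 : (2 * pi) ^+ n.-1 != 0 :> R.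
  by rewrite expf_neq0// mulf_neq0// gt_eqF// pi_gt0.
have I0' : I != 0 by rewrite gt_eqF.
have scale (h : R -> R) (C : R) : measurable_fun [set: T] h ->
    (forall x, `|h x| <= C) ->
    \int[leb]_x ((2 * pi) ^+ n.-1 * (\prod_(i < n) f i x) * h x) =
    (2 * pi) ^+ n.-1 * \int[leb]_x (h x * \prod_(i < n) f i x).
  move=> mh hC; rewrite -(RintegralZl _ measurableT (integrable_mul_prod mh hC)).
  by apply: eq_Rintegral => x _; rewrite -mulrA (mulrC (h x)).
rewrite iter_convolution_charfun// -fmorphV.
rewrite /charfun /Cintegral (Rintegral_conflation mc c1) (Rintegral_conflation ms s1).
rewrite /fourier (scale _ _ mc c1) (scale _ _ ms s1).
apply/eqP; rewrite eq_complex/=; apply/andP; split; apply/eqP; field.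
- by rewrite I0' K0.
- by rewrite I0' K0.
Qed.

(** The dyadic conflations and their total masses converge after multiplication
    by the common factor [2 ^ (j (n - 1))], so the normalized ones converge. *)
Lemma conflation_exists : is_conflation P conflation_probability.
Proof.
pose i0 := Ordinal n_gt0.
move=> h ch hy hNy.
have [C hC] := continuous_vanishing_bounded ch hy hNy.
have mh : measurable_fun [set: T] h by exact: continuous_measurable_fun.
have [M gM] : {M : 'I_n -> R | forall i y, `|g i y| <= M i}.
  have := fun i => cid (inversion_density_bounded (psiL1 i)).
  move=> H; exists (fun i => sval (H i)) => i; exact: svalP (H i).
have limE (u : R -> R) (B : R) : measurable_fun [set: T] u ->
    (forall x, `|u x| <= B) ->
    \int[P i0]_x (u x * \prod_(i < n | i != i0) g i x) =
    \int[leb]_x (u x * \prod_(i < n) f i x).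
  move=> mu_ uB.
  have mug : measurable_fun [set: T] (fun x => u x * \prod_(i < n | i != i0) g i x).
    by apply: measurable_funM => //; exact: measurable_prod_fun.
  have ugB x : `|u x * \prod_(i < n | i != i0) g i x| <=
      B * \prod_(i < n | i != i0) M i.
    rewrite normrM ler_pM// normr_prod.
    by apply: ler_prod => i _; rewrite normr_ge0/=.
  rewrite (Rintegral_density (Pf i0) mug ugB); apply: eq_Rintegral_ae.
  - exact: measurable_funM.
  - exact: measurable_funM.
  - move: ae_density_inversion; apply: filterS => x fg.
    rewrite -mulrA; congr (_ * _); rewrite [RHS](bigD1 i0)//= mulrC; congr (_ * _).
    by apply: eq_bigr => i _; rewrite fg.
have cvgh (u : R -> R) (B : R) : continuous u -> (forall x, `|u x| <= B) ->
    (2 ^+ j) ^+ n.-1 * \int[dyadic_conflation P j]_x u x @[j --> \oo] -->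
    \int[leb]_x (u x * \prod_(i < n) f i x).
  move=> cu uB; rewrite -(limE _ _ _ uB); last exact: continuous_measurable_fun.
  exact: (@conflation_cvg _ _ P i0 _ M (@cg) (@Pg) gM u B cu uB).
have ih := bounded_integrable conflation_probability mh hC.
have QhE : (\int[conflation_probability]_x (h x)%:E =
    ((\int[leb]_x (h x * \prod_(i < n) f i x)) / I)%:E)%E.
  rewrite -(Rintegral_conflation mh hC) /Rintegral fineK//.
  exact: integrable_fin_num ih.
rewrite [X in _ --> X]QhE.
under eq_fun => j.
  rewrite (integral_mnormalize _ (Pcompat j) (dyadic_conflation_lty P i0 j)
    (integrable_dyadic_conflation P i0 j mh hC)).
  over.
apply: cvg_EFin; first exact: nearW.
have den : (2 ^+ j) ^+ n.-1 * fine (dyadic_conflation P j setT) @[j --> \oo] --> I.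
  have c1 : continuous (fun _ : R => 1 : R) by move=> x; exact: cvg_cst.
  have b1 (x : R) : `|1 : R| <= 1 by rewrite normr1.
  have := cvgh (fun _ : R => 1 : R) 1 c1 b1.
  rewrite (_ : \int[leb]_x (1 * \prod_(i < n) f i x) = I); last first.
    by apply: eq_Rintegral => x _; rewrite mul1r.
  apply: cvg_trans; apply: near_eq_cvg; apply: nearW => j.
  by rewrite Rintegral_cst// mul1r.
have num := cvgh h C ch hC.
have I0' : I != 0 by rewrite gt_eqF.
apply: cvg_trans (cvgM num (cvgV I0' den)).
apply: near_eq_cvg; apply: nearW => j /=.
have K0 : (2 ^+ j) ^+ n.-1 != 0 :> R by rewrite !expf_neq0.
have D0 : fine (dyadic_conflation P j setT) != 0.
  rewrite gt_eqF// fine_gt0// Pcompat/=.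
  exact: (dyadic_conflation_lty P i0).
by rewrite /=; field; rewrite D0 K0.
Qed.

End conflation.

End conflation_of_densities.

Theorem theorem3p7 (R : realType) (n : nat) (n_gt0 : (0 < n)%N)
    (P : 'I_n -> probability (measurableTypeR R) R)
    (f : 'I_n -> R -> R)
    (Pcompat : compatible P)
    (Pac : forall i, P i `<< @lebesgue_measure R)
    (Pf : forall i, is_density (P i) (f i))
    (I_gt0 : (0 < \int[@lebesgue_measure R]_x (\prod_(i < n) f i x)%:E)%E)
    (I_fin : (\int[@lebesgue_measure R]_x (\prod_(i < n) f i x)%:E < +oo)%E)
    (psiL1 : forall i, Cintegrable (@lebesgue_measure R) (charfun (P i))) :
  let psi (t : R) : R[i] :=
    iter_convolution (fun i => charfun (P i)) t /
    ((2 * pi) ^+ n.-1 *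
     Rintegral (@lebesgue_measure R) setT (fun x => \prod_(i < n) f i x))%:C in
  exists Q : probability (measurableTypeR R) R,
    [/\ is_conflation P Q,
        Q `<< @lebesgue_measure R,
        forall t, charfun Q t = psi t &
        forall Q' : probability (measurableTypeR R) R,
          Q' `<< @lebesgue_measure R -> (forall t, charfun Q' t = psi t) ->
          forall A, measurable A -> Q' A = Q A].
Proof.
move=> psi; exists (conflation_probability Pf I_gt0 I_fin).
have Qleb : conflation_probability Pf I_gt0 I_fin `<< @lebesgue_measure R.
  exact: density_dominates (conflation_is_density Pf I_gt0 I_fin).
have Qpsi t : charfun (conflation_probability Pf I_gt0 I_fin) t = psi t.
  exact: charfun_conflation.
split => //; first exact: conflation_exists.
move=> Q' Q'leb Q'psi; apply: charfun_inj => // t.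
by rewrite Q'psi Qpsi.
Qed.
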